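(* Let $(G,E,\varphi)$ be a self-similar triple and let $R$ be a unital commutative $*$-ring. If the groupoid $\mathcal{G}_{\text{tight}}(\mathcal{S}_{G,E})$ is Hausdorff, then the $*$-homomorphism $$\pi_{G,E}\colon L_R(G,E)\to A_R(\mathcal{G}_{\text{tight}}(\mathcal{S}_{G,E}))$$ determined by $\pi_{G,E}(p_{v,f})=1_{\Theta_{(v,f,f^{-1}\cdot v)}}$ and $\pi_{G,E}(s_{e,g})=1_{\Theta_{(e,g,g^{-1}\cdot s(e))}}$ ($v\in E^0$, $e\in E^1$, $f,g\in G$) is a $*$-isomorphism.
   Context: A unital commutative $*$-ring $R$ is a commutative ring with $1$ together with an involution $r\mapsto r^*$. A $*$-algebra over $R$ is an (associative, not necessarily unital) $R$-algebra with a map $a\mapsto a^*$ satisfying $(a^* )^*=a$, $(ab)^*=b^*a^*$, $(ra+b)^*=r^*a^*+b^*$. A projection is $p=p^*=p^2$; a partial isometry is $s=ss^*s$. A directed graph $E=(E^0,E^1,r,s)$ has countable vertex set $E^0$, countable edge set $E^1$ and maps $r,s\colon E^1\to E^0$. It is row-finite if $vE^1:=r^{-1}(v)$ is finite for all $v$, and has no sources if $vE^1\neq\emptyset$ for all $v$. An action of a group $G$ on $E$ is a homomorphism from $G$ to the group of bijections of $E^0\sqcup E^1$ that preserve $E^0$ and $E^1$ and commute with $r$ and $s$. A self-similar triple $(G,E,\varphi)$: a countable discrete group $G$ (unit $e_G$), a row-finite graph $E$ with no sources, an action of $G$ on $E$, and a map $\varphi\colon G\times E^1\to G$ with $\varphi(gh,e)=\varphi(g,h\cdot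 e)\varphi(h,e)$ and $\varphi(g,e)\cdot v=g\cdot v$ for all $g,h\in G$, $e\in E^1$, $v\in E^0$. An $E$-family in a $*$-algebra: mutually orthogonal projections $P_v$ ($v\in E^0$) and partial isometries $S_e$ ($e\in E^1$) with $S_e^*S_f=\delta_{e,f}P_{s(e)}$ and $P_v=\sum_{e\in vE^1}S_eS_e^*$. A $(G,E)$-family: elements $P_{v,f}$, $S_{e,g}$ ($v\in E^0$, $e\in E^1$, $f,g\in G$) such that (a) $\{P_{v,e_G}\}\cup\{S_{e,e_G}\}$ is an $E$-family; (b) $(P_{v,f})^*=P_{f^{-1}\cdot v,f^{-1}}$; (c) $P_{v,f}P_{w,h}=\delta_{v,f\cdot w}P_{v,fh}$; (d) $P_{v,f}S_{e,g}=\delta_{v,r(f\cdot e)}S_{f\cdot e,\varphi(f,e)g}$; (e) $S_{e,g}P_{v,f}=\delta_{g\cdot v,s(e)}S_{e,gf}$. $L_R(G,E)$ is the universal $*$-algebra over $R$ generated by a $(G,E)$-family $\{p_{v,f},s_{e,g}\}$. Paths are $\alpha=\alpha_1\cdots\alpha_n$ with $\alpha_i\in E^1$, $s(\alpha_i)=r(\alpha_{i+1})$, $r(\alpha)=r(\alpha_1)$, $s(\alpha)=s(\alpha_n)$; vertices are paths of length $0$; $E^*$ is the set of finite paths and $E^\infty$ the set of infinite paths $e_1e_2\cdots$ ($s(e_i)=r(e_{i+1})$) with the topology having basis $Z(\beta)=\{\beta x: x\in E^\infty, r(x)=s(\beta)\}$, $\beta\in E^*$. The action and cocycle extend to $E^*$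 by $\varphi(g,v)=g$ for $v\in E^0$, $g\cdot(\alpha e)=(g\cdot\alpha)(\varphi(g,\alpha)\cdot e)$, $\varphi(g,\alpha e)=\varphi(\varphi(g,\alpha),e)$, and $G$ acts on $E^\infty$ so that $g\cdot x$ has initial segments $g\cdot(e_1\cdots e_n)$. $\mathcal{S}_{G,E}=\{(\alpha,g,\beta)\in E^*\times G\times E^*: s(\alpha)=g\cdot s(\beta)\}\cup\{0\}$ is an inverse semigroup with zero $0$, $(\alpha,g,\beta)^*=(\beta,g^{-1},\alpha)$ and product $(\alpha,g,\beta)(\gamma,h,\delta)=(\alpha(g\cdot\varepsilon),\varphi(g,\varepsilon)h,\delta)$ if $\gamma=\beta\varepsilon$, $=(\alpha,g\varphi(h^{-1},\varepsilon)^{-1},\delta(h^{-1}\cdot\varepsilon))$ if $\beta=\gamma\varepsilon$, and $0$ otherwise. It acts on $E^\infty$: $s=(\alpha,g,\beta)$ maps $Z(\beta)$ to $Z(\alpha)$ by $s\cdot(\beta x)=\alpha(g\cdot x)$. $\mathcal{G}_{\text{tight}}(\mathcal{S}_{G,E})$ is the groupoid of germs of this action: elements $[s,x]$ with $s=(\alpha,g,\beta)$, $x\in Z(\beta)$, where $[s,x]=[t,y]$ iff $x=y$ and there is $e=(\gamma,e_G,\gamma)$ with $x\in Z(\gamma)$ and $se=te$; source $x$, range $s\cdot x$, product $[s,t\cdot x][t,x]=[st,x]$, inverse $[s,x]^{-1}=[s^*,s\cdot x]$; unit space identified with $E^\infty$. For $s=(\alpha,g,\beta)$ put $\Theta_s=\{[s,x]:x\in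 Z(\beta)\}$; these sets are a basis of compact open bisections for the topology. For an ample groupoid $\mathcal{G}$ with Hausdorff unit space, the Steinberg algebra is $A_R(\mathcal{G})=\operatorname{span}_R\{1_B: B\text{ a compact open bisection}\}\subseteq R^{\mathcal{G}}$ with product $(fg)(\gamma)=\sum_{\alpha\beta=\gamma}f(\alpha)g(\beta)$ and involution $f^*(\gamma)=f(\gamma^{-1})^*$. *)

(* Defs.v *)
From HB Require Import structures.
From mathcomp Require Import all_boot all_order all_algebra.
From mathcomp Require Import zify.
From mathcomp Require Import all_classical topology numfun.

Set Implicit Arguments.
Unset Strict Implicit.
Unset Printing Implicit Defensive.

Import GRing.Theory.

Local Open Scope classical_set_scope.
Local Open Scope quotient_scope.
Local Open Scope group_scope.

Record graph := Graph {
  vert : countType;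
  edge : countType;
  rng : edge -> vert;
  src : edge -> vert }.

Definition row_finite (E : graph) : Prop :=
  forall v : vert E, finite_set [set e | rng e = v].

Definition no_sources (E : graph) : Prop :=
  forall v : vert E, [set e | rng e = v] !=set0.

(* [actv] and [acte] are the two restrictions of an action on the disjoint
   union of the vertices and the edges; bijectivity of each [actv g] and
   [acte g] follows from the group action laws. *)
Record graph_action (G : groupType) (E : graph) := GraphAction {
  actv : G -> vert E -> vert E;
  acte : G -> edge E -> edge E;
  actv1 : forall v, actv 1 v = v;
  acte1 : forall e, acte 1 e = e;
  actvM : forall g h v, actv (g * h) v = actv g (actv h v);
  acteM : forall g h e, acte (g * h) e = acte g (acte h e);
  rng_act : forall g e, rng (acte g e) = actv g (rng e);
  src_act : forall g e, src (acte g e) = actv g (src e) }.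

Record self_similar := SelfSimilar {
  grp : groupType;
  grp_countable : countable [set: grp];
  gph : graph;
  gph_row_finite : row_finite gph;
  gph_no_sources : no_sources gph;
  gact : graph_action grp gph;
  phi : grp -> edge gph -> grp;
  phiM : forall g h e, phi (g * h) e = phi g (acte gact h e) * phi h e;
  phi_act : forall g e v, actv gact (phi g e) v = actv gact g v }.

Arguments phi {s} _ _.

Notation av := (actv (gact _)).
Notation ae := (acte (gact _)).

Section Paths.
Variable T : self_similar.
Notation G := (grp T).
Notation E0 := (vert (gph T)).
Notation E1 := (edge (gph T)).

(* A path is encoded by its range and its sequence of edges, so that a vertex
   [v] is the path [(v, [::])]; [is_path] selects the sequences that are
   composable and start at the given range. *)
Definition prepath : Type := E0 * seq E1.

Fixpoint composable (v : E0) (es : seq E1) : bool :=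
  if es is e :: es' then (rng e == v) && composable (src e) es' else true.

Definition is_path (a : prepath) : bool := composable a.1 a.2.

Definition prng (a : prepath) : E0 := a.1.
Definition psrc (a : prepath) : E0 := last a.1 [seq src e | e <- a.2].

Definition vpath (v : E0) : prepath := (v, [::]).
Definition epath (e : E1) : prepath := (rng e, [:: e]).

Definition pcat (a b : prepath) : prepath := (a.1, a.2 ++ b.2).

(* The recursions on the last edge of a path are [act_seq_rcons] and
   [phis_rcons]. *)
Fixpoint act_seq (g : G) (es : seq E1) : seq E1 :=
  if es is e :: es' then ae g e :: act_seq (phi g e) es' else [::].

Definition phis (g : G) (es : seq E1) : G := foldl phi g es.

Definition pact (g : G) (a : prepath) : prepath := (av g a.1, act_seq g a.2).
Definition pphi (g : G) (a : prepath) : G := phis g a.2.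

(* [pprefix b c] holds when [c = b d] for some path [d], and then [ptail b c]
   is this [d]. *)
Definition pprefix (b c : prepath) : bool := (b.1 == c.1) && prefix b.2 c.2.
Definition ptail (b c : prepath) : prepath := (psrc b, drop (size b.2) c.2).

Lemma phi1 (e : E1) : phi 1 e = 1.
Proof.
have := phiM 1 1 e; rewrite mulg1 acte1 => H.
by apply: (mulgI (phi 1 e)); rewrite mulg1 -H.
Qed.

Lemma act_seq_cat g (s t : seq E1) :
  act_seq g (s ++ t) = act_seq g s ++ act_seq (phis g s) t.
Proof. by elim: s g => //= e s IH g; rewrite IH. Qed.

Lemma act_seq_rcons g (s : seq E1) e :
  act_seq g (rcons s e) = rcons (act_seq g s) (ae (phis g s) e).
Proof. by rewrite -!cats1 act_seq_cat. Qed.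

Lemma phis_cat g (s t : seq E1) : phis g (s ++ t) = phis (phis g s) t.
Proof. exact: foldl_cat. Qed.

Lemma phis_rcons g (s : seq E1) e : phis g (rcons s e) = phi (phis g s) e.
Proof. by rewrite -cats1 phis_cat. Qed.

Lemma size_act_seq g (s : seq E1) : size (act_seq g s) = size s.
Proof. by elim: s g => //= e s IH g; rewrite IH. Qed.

Lemma act_seq1 (s : seq E1) : act_seq 1 s = s.
Proof. by elim: s => //= e s IH; rewrite phi1 acte1 IH. Qed.

Lemma phis1 (s : seq E1) : phis 1 s = 1.
Proof. by elim: s => //= e s IH; rewrite phi1 IH. Qed.

Lemma act_seqM g h (s : seq E1) : act_seq (g * h) s = act_seq g (act_seq h s).
Proof. by elim: s g h => //= e s IH g h; rewrite acteM phiM IH. Qed.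

Lemma phisM g h (s : seq E1) :
  phis (g * h) s = phis g (act_seq h s) * phis h s.
Proof. by elim: s g h => //= e s IH g h; rewrite phiM IH. Qed.

Lemma phis_act g (s : seq E1) (v : E0) : av (phis g s) v = av g v.
Proof. by elim: s g => //= e s IH g; rewrite IH phi_act. Qed.

Lemma avK g : cancel (av g) (actv (gact T) g^-1).
Proof. by move=> v; rewrite -actvM mulVg actv1. Qed.

Lemma avVK g : cancel (actv (gact T) g^-1) (av g).
Proof. by move=> v; rewrite -actvM mulgV actv1. Qed.

Lemma av_inj g : injective (actv (gact T) g).
Proof. exact: can_inj (avK g). Qed.

Lemma phisV_act g (s : seq E1) (v : E0) :
  actv (gact T) (phis g s)^-1 v = av g^-1 v.
Proof. by apply: (@av_inj (phis g s)); rewrite avVK phis_act avVK. Qed.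

Lemma composable_cat v (s t : seq E1) :
  composable v (s ++ t) =
  composable v s && composable (last v [seq src e | e <- s]) t.
Proof. by elim: s v => //= e s IH v; rewrite IH andbA. Qed.

Lemma psrc_cat v (s t : seq E1) :
  psrc (v, s ++ t) = psrc (psrc (v, s), t).
Proof. by rewrite /psrc /= map_cat last_cat. Qed.

Lemma composable_act g v (s : seq E1) :
  composable (av g v) (act_seq g s) = composable v s.
Proof.
elim: s g v => //= e s IH g v.
by rewrite rng_act (inj_eq (@av_inj g)) src_act -(phi_act g e) IH.
Qed.

Lemma psrc_act g (a : prepath) : psrc (pact g a) = av g (psrc a).
Proof.
case: a => v s; rewrite /psrc /=.
by elim: s g v => //= e s IH g v; rewrite src_act -(phi_act g e) IH phi_act.
Qed.

Lemma is_path_act g (a : prepath) : is_path (pact g a) = is_path a.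
Proof. exact: composable_act. Qed.

Lemma pprefixP (b c : prepath) :
  reflect (exists d : prepath, c = pcat b d) (pprefix b c).
Proof.
apply: (iffP andP) => [[/eqP bc /prefixP[s cE]]|[d ->]].
  by exists (psrc b, s); rewrite /pcat /= -cE bc; case: (c).
by split => //=; exact: prefix_prefix.
Qed.

Lemma pcat_ptail (b c : prepath) : pprefix b c -> pcat b (ptail b c) = c.
Proof.
by move=> /pprefixP[d ->]; rewrite /pcat /ptail /= drop_size_cat.
Qed.

Record ipath := IPath {
  iseq :> nat -> E1;
  ipathP : forall n, src (iseq n) = rng (iseq n.+1) }.

HB.instance Definition _ := gen_eqMixin ipath.
HB.instance Definition _ := gen_choiceMixin ipath.

Lemma ipath_inj (x y : ipath) : iseq x =1 iseq y -> x = y.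
Proof.
case: x y => [x Px] [y Py] /= /funext xy; case: _ / xy Py => Py.
by congr IPath; exact: Prop_irrelevance.
Qed.

Definition irng (x : ipath) : E0 := rng (x 0).

Definition icat (s : seq E1) (x : nat -> E1) : nat -> E1 :=
  fun n => nth (x (n - size s)%N) s n.

Definition cyl (b : prepath) : set ipath :=
  [set x | exists2 y : ipath, irng y = psrc b & x = icat b.2 y :> (nat -> E1)].

Lemma iact_subproof g (x : ipath) n :
  src (ae (phis g (mkseq x n)) (x n)) =
  rng (ae (phis g (mkseq x n.+1)) (x n.+1)).
Proof.
by rewrite src_act rng_act -ipathP (mkseqS x) phis_rcons phi_act.
Qed.

Definition iact (g : G) (x : ipath) : ipath :=
  IPath (iact_subproof g x).

Lemma mkseq_iact g (x : ipath) n : mkseq (iact g x) n = act_seq g (mkseq x n).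
Proof.
by elim: n => // n IH; rewrite mkseqS IH mkseqS act_seq_rcons.
Qed.

Lemma irng_iact g (x : ipath) : irng (iact g x) = av g (irng x).
Proof. by rewrite /irng /= rng_act. Qed.

Definition shift (n : nat) (x : ipath) : ipath :=
  @IPath (fun k => x (n + k)%N) (fun k => etrans (ipathP x _)
    (congr1 (fun m => rng (x m)) (esym (addnS n k)))).

End Paths.

Section Cylinders.
Variable T : self_similar.
Notation G := (grp T).
Notation E0 := (vert (gph T)).
Notation E1 := (edge (gph T)).
Implicit Types (x y : ipath T) (a b c : prepath T).

Definition iprefix x n : prepath T := (irng x, mkseq x n).

Lemma composable_mkseq x n : composable (irng x) (mkseq x n).
Proof.
elim: n => // n IH; rewrite mkseqS -cats1 composable_cat IH /= andbT.
case: n {IH} => [|n]; first by rewrite eqxx.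
by rewrite mkseqS map_rcons last_rcons ipathP.
Qed.

Lemma is_path_iprefix x n : is_path (iprefix x n).
Proof. exact: composable_mkseq. Qed.

Lemma psrc_iprefix x n : psrc (iprefix x n) = irng (shift n x).
Proof.
rewrite /psrc /iprefix /irng /= addn0.
by case: n => // n; rewrite mkseqS map_rcons last_rcons ipathP.
Qed.

Lemma mkseqD x m n : mkseq x (m + n) = mkseq x m ++ mkseq (shift m x) n.
Proof.
rewrite /mkseq iotaD map_cat add0n; congr (_ ++ _).
by rewrite -[X in iota X _]addn0 iotaDl -map_comp; exact: eq_map.
Qed.

Lemma shift_shift m n x : shift n (shift m x) = shift (m + n) x.
Proof. by apply: ipath_inj => k /=; rewrite addnA. Qed.

Lemma icat_shift x n : icat (mkseq x n) (shift n x) = x.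
Proof.
apply: funext => k; rewrite /icat size_mkseq.
have [kn|nk] := ltnP k n; first by rewrite nth_mkseq.
by rewrite nth_default ?size_mkseq //= subnKC.
Qed.

Lemma mkseq_icat (s : seq E1) y : mkseq (icat s y) (size s) = s.
Proof.
apply: (@eq_from_nth _ (y 0)); rewrite size_mkseq // => i si.
by rewrite nth_mkseq // /icat; exact: set_nth_default.
Qed.

Lemma cylP b x : is_path b -> cyl b x <-> iprefix x (size b.2) = b.
Proof.
case: b => v s /= ps; split=> [[y yr xE]|].
  rewrite /iprefix xE mkseq_icat; congr pair; rewrite /irng xE /icat.
  case: s ps yr {xE} => [|e s] //=; rewrite /is_path /=.
  by case/andP => /eqP.
move=> bE; exists (shift (size s) x); first by rewrite -psrc_iprefix bE.
by case: bE => _ sE; rewrite -{1}sE icat_shift.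
Qed.

Lemma cyl_mkseq b x : is_path b -> cyl b x -> mkseq x (size b.2) = b.2.
Proof. by move=> pb /(cylP _ pb) bE; rewrite -{2}bE. Qed.

Lemma composable_icat v (s : seq E1) y : composable v s ->
  irng y = psrc (v, s) ->
  forall n, src (icat s y n) = rng (icat s y n.+1).
Proof.
rewrite /psrc /= => vs ys n; elim: s v n vs ys => [|e s IH] v n /=.
  by move=> _ _; rewrite /icat !nth_nil !subn0; exact: ipathP.
case/andP => _ es ys; case: n => [|n]; last first.
  by have := IH _ n es ys; rewrite /icat /= !subSS.
rewrite /icat /= subSS.
case: s es ys {IH} => [|f s] /=; first by move=> _ <-.
by case/andP => /eqP.
Qed.

Lemma cyl_shift b x : is_path b -> cyl b x ->
  irng (shift (size b.2) x) = psrc b.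
Proof. by move=> pb /(cylP _ pb) <-; rewrite psrc_iprefix size_mkseq. Qed.

End Cylinders.

Section InverseSemigroup.
Variable T : self_similar.
Notation G := (grp T).
Notation E0 := (vert (gph T)).
Notation E1 := (edge (gph T)).
Implicit Types (x y : ipath T) (a b c : prepath T).

Definition pretriple : Type := prepath T * G * prepath T.

Definition is_triple (t : pretriple) : bool :=
  let: (a, g, b) := t in [&& is_path a, is_path b & psrc a == av g (psrc b)].

(* The nonzero elements of the inverse semigroup. *)
Record triple := Triple { tval :> pretriple; tvalP : is_triple tval }.

HB.instance Definition _ := [isSub for tval].
HB.instance Definition _ := [Equality of triple by <:].
HB.instance Definition _ := [Choice of triple by <:].

Definition tleft (t : triple) : prepath T := (tval t).1.1.
Definition tgrp (t : triple) : G := (tval t).1.2.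
Definition tright (t : triple) : prepath T := (tval t).2.

Definition pre_mul (s t : pretriple) : option pretriple :=
  let: (a, g, b) := s in
  let: (c, h, d) := t in
  if pprefix b c then
    let e := ptail b c in Some (pcat a (pact g e), pphi g e * h, d)
  else if pprefix c b then
    let e := ptail c b in Some (a, g * (pphi h^-1 e)^-1, pcat d (pact h^-1 e))
  else None.

Definition pre_star (t : pretriple) : pretriple :=
  let: (a, g, b) := t in (b, g^-1, a).

(* [SGE] is the inverse semigroup, with zero [None]. *)
Definition SGE : Type := option triple.

(* By [pre_mul_triple], [insub] never fails here. *)
Definition triple_mul (s t : triple) : SGE := obind insub (pre_mul s t).

Definition smul (s t : SGE) : SGE :=
  if s is Some s' then (if t is Some t' then triple_mul s' t' else None)
  else None.

Lemma pre_mul_triple (s t u : pretriple) :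
  is_triple s -> is_triple t -> pre_mul s t = Some u -> is_triple u.
Proof.
case: s => -[a g] b; case: t => -[c h] d /=.
case/and3P => pa pb /eqP ab; case/and3P => pc pd /eqP cd.
have tailP (k l : prepath T) : is_path l -> pprefix k l ->
    is_path (ptail k l) /\ psrc (ptail k l) = psrc l.
  move=> pl kl; have E := pcat_ptail kl; split; last first.
    by rewrite -[in RHS]E /pcat psrc_cat; case: (k).
  by move: pl; rewrite -{1}E /is_path composable_cat => /andP[].
have catP (k l : prepath T) : is_path k -> is_path l -> psrc k = prng l ->
    is_path (pcat k l) /\ psrc (pcat k l) = psrc l.
  case: k => kv ks pk pl kl; rewrite /pcat psrc_cat kl; split; last by case: (l).
  by rewrite /is_path composable_cat [X in X && _]pk -[last _ _]/(psrc (kv, ks)) kl.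
case: ifP => [bc [<-] /=|_].
  have [pt st] := tailP _ _ pc bc.
  have [pp ->] : is_path (pcat a (pact g (ptail b c))) /\
      psrc (pcat a (pact g (ptail b c))) = psrc (pact g (ptail b c)).
    by apply: catP; rewrite ?is_path_act.
  by rewrite pp pd psrc_act st cd actvM phis_act eqxx.
case: ifP => // cb [<-] /=.
have [pt st] := tailP _ _ pb cb.
have [pp ->] : is_path (pcat d (pact h^-1 (ptail c b))) /\
    psrc (pcat d (pact h^-1 (ptail c b))) = psrc (pact h^-1 (ptail c b)).
  by apply: catP; rewrite ?is_path_act //= cd avK.
by rewrite pa pp psrc_act st ab actvM phisV_act invgK avVK eqxx.
Qed.

Lemma pre_star_triple (t : pretriple) : is_triple t -> is_triple (pre_star t).
Proof.
by case: t => -[a g] b /= /and3P[-> -> /eqP ->]; rewrite avK eqxx.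
Qed.

Definition tstar (t : triple) : triple := Triple (pre_star_triple (tvalP t)).

Lemma idem_triple b : is_path b -> is_triple (b, 1, b).
Proof. by move=> pb; rewrite /is_triple pb actv1 eqxx. Qed.

Definition tidem b (pb : is_path b) : triple := Triple (idem_triple pb).

Lemma vtriple_subproof (v : E0) (f : G) :
  is_triple (vpath v, f, vpath (av f^-1 v)).
Proof. by rewrite /is_triple /= /psrc /= avVK eqxx. Qed.

Definition vtriple v f : triple := Triple (vtriple_subproof v f).

Lemma etriple_subproof (e : E1) (g : G) :
  is_triple (epath e, g, vpath (av g^-1 (src e))).
Proof. by rewrite /is_triple /is_path /psrc /= !eqxx avVK eqxx. Qed.

Definition etriple e g : triple := Triple (etriple_subproof e g).

Lemma triple_eta (t : triple) : tval t = (tleft t, tgrp t, tright t).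
Proof. by case: t => -[[a g] b]. Qed.

Lemma tleftP (t : triple) : is_path (tleft t).
Proof. by have := tvalP t; rewrite triple_eta => /and3P[]. Qed.

Lemma trightP (t : triple) : is_path (tright t).
Proof. by have := tvalP t; rewrite triple_eta => /and3P[]. Qed.

Lemma psrc_tleft (t : triple) : psrc (tleft t) = av (tgrp t) (psrc (tright t)).
Proof. by have := tvalP t; rewrite triple_eta => /and3P[_ _ /eqP]. Qed.

Lemma act_triple_subproof (t : triple) x (tx : cyl (tright t) x) n :
  let z := icat (tleft t).2 (iact (tgrp t) (shift (size (tright t).2) x)) in
  src (z n) = rng (z n.+1).
Proof.
apply: (@composable_icat _ (tleft t).1); first exact: tleftP.
rewrite irng_iact cyl_shift //; last exact: trightP.
by rewrite -psrc_tleft; case: (tleft t).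
Qed.

(* [t . (b x) = a (g . x)] for [t = (a, g, b)]. *)
Definition act_triple (t : triple) x (tx : cyl (tright t) x) : ipath T :=
  IPath (act_triple_subproof tx).

Lemma act_triple_cyl (t : triple) x (tx : cyl (tright t) x) :
  cyl (tleft t) (act_triple tx).
Proof.
exists (iact (tgrp t) (shift (size (tright t).2) x)) => //.
by rewrite irng_iact cyl_shift ?psrc_tleft //; exact: trightP.
Qed.

End InverseSemigroup.

Section Germs.
Variable T : self_similar.
Implicit Types (x y : ipath T) (b c : prepath T) (s t u : triple T).

Record pregerm := PreGerm {
  pg_triple : triple T;
  pg_path : ipath T;
  pg_cyl : cyl (tright pg_triple) pg_path }.

HB.instance Definition _ := gen_eqMixin pregerm.
HB.instance Definition _ := gen_choiceMixin pregerm.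

Definition germ_eq (p q : pregerm) : Prop :=
  pg_path p = pg_path q /\
  exists c (pc : is_path c), cyl c (pg_path p) /\
    smul (Some (pg_triple p)) (Some (tidem pc)) =
    smul (Some (pg_triple q)) (Some (tidem pc)).

Lemma pprefix_iprefix x m n : pprefix (iprefix x m) (iprefix x n) = (m <= n)%N.
Proof.
rewrite /pprefix eqxx /= prefixE size_mkseq.
apply/eqP/idP => [|mn].
  by move/(congr1 size); rewrite size_take !size_mkseq; case: ltnP => [/ltnW|_ ->].
apply: (@eq_from_nth _ (x 0)); rewrite size_takel ?size_mkseq // => i im.
by rewrite nth_take // !nth_mkseq // (leq_trans im).
Qed.

Lemma ptail_iprefix x m n : (m <= n)%N ->
  ptail (iprefix x m) (iprefix x n) = iprefix (shift m x) (n - m).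
Proof.
move=> mn; rewrite /ptail psrc_iprefix /iprefix /=; congr pair.
apply: (@eq_from_nth _ (x 0)); rewrite size_drop !size_mkseq // => i im.
by rewrite nth_drop !nth_mkseq // -ltn_subRL.
Qed.

(* Product with the idempotent of the initial segment of [x] of length [n]. *)
Lemma pre_mul_idem (a : prepath T) g x m n :
  pre_mul (a, g, iprefix x m) (iprefix x n, 1, iprefix x n) =
  Some (if (m <= n)%N then
          let e := iprefix (shift m x) (n - m) in
          (pcat a (pact g e), pphi g e, iprefix x n)
        else (a, g, iprefix x m)).
Proof.
rewrite /pre_mul !pprefix_iprefix.
case: leqP => [mn|/ltnW nm]; first by rewrite ptail_iprefix // mulg1.
rewrite nm invg1 /pphi phis1 invg1 mulg1; congr (Some (_, _, _)).
rewrite ptail_iprefix // /pcat /pact /= act_seq1 -/(iprefix x m).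
congr pair; have := @pcat_ptail _ (iprefix x n) (iprefix x m).
by rewrite pprefix_iprefix ptail_iprefix // => /(_ nm) [].
Qed.

Lemma pprefix_refl b : pprefix b b.
Proof. by rewrite /pprefix eqxx prefix_refl. Qed.

Definition tres (t : triple T) x n : option (pretriple T) :=
  pre_mul t (iprefix x n, 1, iprefix x n).

Lemma smul_res t c (pc : is_path c) x : cyl c x -> cyl (tright t) x ->
  exists u, smul (Some t) (Some (tidem pc)) = Some u /\
    Some (tval u) = tres t x (size c.2).
Proof.
move=> cx tx; rewrite /tres (_ : iprefix x _ = c); last exact/cylP.
rewrite [smul _ _]/= /triple_mul [tval (tidem _)]/=.
case E : (pre_mul _ _) => [u|].
  have uP := pre_mul_triple (tvalP t) (tvalP (tidem pc)) E.
  by exists (Triple uP); rewrite /= insubT.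
exfalso; move: E; rewrite triple_eta -((cylP _ (trightP t)).1 tx).
by rewrite -((cylP _ pc).1 cx) pre_mul_idem.
Qed.

Lemma germ_eqP (p q : pregerm) : germ_eq p q <->
  pg_path p = pg_path q /\
  exists n, tres (pg_triple p) (pg_path p) n = tres (pg_triple q) (pg_path p) n.
Proof.
case: p q => [s x sx] [t y ty]; split=> /= -[/= xy]; case: _ / xy ty => tx.
  case=> c [pc [cx H]]; split=> //; exists (size c.2).
  have [u [uE <-]] := smul_res pc cx sx.
  have [v [vE <-]] := smul_res pc cx tx.
  by congr (Some (tval _)); apply: Some_inj; rewrite -uE -vE.
case=> n H; split=> //; exists (iprefix x n), (is_path_iprefix x n) => /=.
have cx : cyl (iprefix x n) x.
  by apply/cylP; [exact: is_path_iprefix|rewrite size_mkseq].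
split=> //.
have [u [uE uv]] := smul_res (is_path_iprefix x n) cx sx.
have [v [vE vv]] := smul_res (is_path_iprefix x n) cx tx.
suff uv' : u = v by move: uE vE; rewrite uv' /= => -> ->.
by apply: val_inj; apply: Some_inj; rewrite /= uv vv size_mkseq.
Qed.

Lemma tright_prefix t x : cyl (tright t) x ->
  tval t = (tleft t, tgrp t, iprefix x (size (tright t).2)).
Proof.
move=> tx; rewrite (cylP _ (trightP t)).1 // /tleft /tgrp /tright.
by case: (tval t) => -[].
Qed.

Lemma tresS t x m n : cyl (tright t) x -> (m <= n)%N ->
  tres t x n = obind (fun r => pre_mul r (iprefix x n, 1, iprefix x n))
                     (tres t x m).
Proof.
move=> tx mn; rewrite /tres (tright_prefix tx).
set k := size _; rewrite !pre_mul_idem [obind _ _]/=.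
case: (leqP k m) => [km|mk]; last by rewrite pre_mul_idem.
rewrite pre_mul_idem mn (leq_trans km mn); congr Some.
have nkE : (n - k = (m - k) + (n - m))%N by lia.
have E : mkseq (shift k x) (n - k) =
   mkseq (shift k x) (m - k) ++ mkseq (shift m x) (n - m).
  by rewrite nkE mkseqD shift_shift subnKC.
congr (_, _, _); rewrite /pphi /pcat /pact /=.
  by rewrite E act_seq_cat catA.
by rewrite E phis_cat.
Qed.

Lemma tresW s t x m n : cyl (tright s) x -> cyl (tright t) x -> (m <= n)%N ->
  tres s x m = tres t x m -> tres s x n = tres t x n.
Proof. by move=> sx tx mn E; rewrite (tresS sx mn) (tresS tx mn) E. Qed.

Definition germ_rel (p q : pregerm) : bool := `[< germ_eq p q >].

Lemma germ_rel_equiv : equiv_class_of germ_rel.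
Proof.
split=> [p|p q|q p r].
- by apply/asboolP/germ_eqP; split=> //; exists 0.
- suff H (a1 a2 : pregerm) : germ_eq a1 a2 -> germ_eq a2 a1.
    by apply/asboolP/asboolP; exact: H.
  move=> /germ_eqP [E [n H]]; apply/germ_eqP; split=> //; exists n.
  by rewrite -E H.
- move=> /asboolP/germ_eqP[pq [n H1]] /asboolP/germ_eqP[qr [m H2]].
  apply/asboolP/germ_eqP; split; first by rewrite pq.
  case: p q r H1 H2 pq qr => [s x sx] [t y ty] [u z uz] /= + + xy yz.
  case: _ / xy ty yz => tx yz; case: _ / yz uz => ux H1 H2.
  exists (maxn n m); rewrite (tresW sx tx (leq_maxl n m) H1).
  by rewrite (tresW tx ux (leq_maxr n m) H2).
Qed.

Canonical germ_equiv := EquivRelPack germ_rel_equiv.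

Definition Gtight := {eq_quot germ_equiv}.
HB.instance Definition _ := Choice.on Gtight.
HB.instance Definition _ := Quotient.on Gtight.

Definition germ s x (sx : cyl (tright s) x) : Gtight :=
  \pi_Gtight (PreGerm sx).

Lemma germP s x (sx : cyl (tright s) x) t y (ty : cyl (tright t) y) :
  germ sx = germ ty <-> germ_eq (PreGerm sx) (PreGerm ty).
Proof. by split=> [/eqmodP/asboolP|H] //; apply/eqmodP/asboolP. Qed.

Lemma germ_repr (z : Gtight) : germ (pg_cyl (repr z)) = z.
Proof.
by rewrite /germ -[RHS]reprK; case: (repr z).
Qed.

Definition gsrc (z : Gtight) : ipath T := pg_path (repr z).

Definition grng (z : Gtight) : ipath T := act_triple (pg_cyl (repr z)).

Lemma tstar_cyl s x (sx : cyl (tright s) x) :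
  cyl (tright (tstar s)) (act_triple sx).
Proof.
have -> : tright (tstar s) = tleft s by case: (s) => -[[a g] b].
exact: act_triple_cyl.
Qed.

Definition ginv (z : Gtight) : Gtight := germ (tstar_cyl (pg_cyl (repr z))).

(* [gmul z w v] says that [z] and [w] are composable with product [v]. *)
Definition gmul (z w v : Gtight) : Prop :=
  exists s t u x (tx : cyl (tright t) x)
    (sx : cyl (tright s) (act_triple tx)) (ux : cyl (tright u) x),
    [/\ smul (Some s) (Some t) = Some u,
        z = germ sx, w = germ tx & v = germ ux].

Lemma gsrc_germ s x (sx : cyl (tright s) x) : gsrc (germ sx) = x.
Proof.
rewrite /gsrc; have := germ_repr (germ sx); case: (repr _) => t y ty /=.
by move/germP => -[].
Qed.

Lemma iact_icat g x n :
  iact g x = icat (act_seq g (mkseq x n)) (iact (phis g (mkseq x n)) (shift n x))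
    :> (nat -> _).
Proof.
apply: funext => k; rewrite /icat size_act_seq size_mkseq.
have [kn|nk] := ltnP k n.
  by rewrite -mkseq_iact nth_mkseq.
rewrite nth_default ?size_act_seq ?size_mkseq //= subnKC //.
rewrite -phis_cat; congr (ae (phis _ _) _).
by rewrite -mkseqD subnKC.
Qed.

Lemma icat_cat (r q : seq (edge (gph T))) (y : nat -> edge (gph T)) :
  icat (r ++ q) y = icat r (icat q y).
Proof.
apply: funext => k; rewrite /icat nth_cat size_cat.
case: ltnP => [kr|rk]; first exact: set_nth_default.
by rewrite [RHS]nth_default // subnDA.
Qed.

Lemma tresE t x n : cyl (tright t) x -> (size (tright t).2 <= n)%N ->
  tres t x n = Some (let e := iprefix (shift (size (tright t).2) x)
                                 (n - size (tright t).2) in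
     (pcat (tleft t) (pact (tgrp t) e), pphi (tgrp t) e, iprefix x n)).
Proof.
by move=> tx tn; rewrite /tres (tright_prefix tx) pre_mul_idem tn.
Qed.

Lemma act_triple_res t x (tx : cyl (tright t) x) n a g c :
  (size (tright t).2 <= n)%N -> tres t x n = Some (a, g, c) ->
  act_triple tx = icat a.2 (iact g (shift n x)) :> (nat -> _).
Proof.
move=> tn; rewrite (tresE tx tn) => -[<- <- _].
rewrite -[LHS]/(icat (tleft t).2 (iact (tgrp t) (shift (size (tright t).2) x))).
by rewrite (iact_icat _ _ (n - size (tright t).2)) -icat_cat shift_shift subnKC.
Qed.

Lemma germ_eq_large s t x (sx : cyl (tright s) x) (tx : cyl (tright t) x) :
  germ_eq (PreGerm sx) (PreGerm tx) -> exists n,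
  [/\ (size (tright s).2 <= n)%N, (size (tright t).2 <= n)%N &
      tres s x n = tres t x n].
Proof.
move=> /germ_eqP[_ [n H]].
exists (maxn n (maxn (size (tright s).2) (size (tright t).2))).
by split; [lia|lia|exact: tresW (leq_maxl _ _) H].
Qed.

Lemma grng_germ s x (sx : cyl (tright s) x) : grng (germ sx) = act_triple sx.
Proof.
rewrite /grng; have := germ_repr (germ sx); case: (repr _) => t y ty /=.
move/germP => H; have [/= E _] := H; case: _ / E sx H => sx H.
have [n [tn sn E]] := germ_eq_large H; apply: ipath_inj => k.
move: (tresE sx sn); set r := (X in Some X).
case: r => -[a g] c sr.
by rewrite (act_triple_res sx sn sr) (act_triple_res ty tn (etrans E sr)).
Qed.

Lemma shift_act_triple t x (tx : cyl (tright t) x) :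
  shift (size (tleft t).2) (act_triple tx) =
  iact (tgrp t) (shift (size (tright t).2) x).
Proof.
apply: ipath_inj => k; rewrite [LHS]/= /icat nth_default ?leq_addr //.
by rewrite addKn.
Qed.

Lemma tres_tstar t x (tx : cyl (tright t) x) n :
  (size (tright t).2 <= n)%N ->
  tres (tstar t) (act_triple tx)
    (size (tleft t).2 + (n - size (tright t).2)) =
  omap (@pre_star T) (tres t x n).
Proof.
move=> tn; have tsx := tstar_cyl tx.
have slE : tleft (tstar t) = tright t by case: (t) => -[[a g] b].
have srE : tright (tstar t) = tleft t by case: (t) => -[[a g] b].
have sgE : tgrp (tstar t) = (tgrp t)^-1 by case: (t) => -[[a g] b].
rewrite (tresE tx tn) (tresE tsx) srE ?leq_addr // slE sgE addKn.
rewrite shift_act_triple /= /pre_star; set g := tgrp t.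
set k := (n - _)%N; set z := shift _ x.
have mE : mkseq (iact g z) k = act_seq g (mkseq z k) by rewrite mkseq_iact.
have zE : mkseq (act_triple tx) (size (tleft t).2 + k) =
    (tleft t).2 ++ act_seq g (mkseq z k).
  by rewrite -mE -shift_act_triple mkseqD (cyl_mkseq (tleftP t)) //;
     exact: act_triple_cyl.
congr (Some (_, _, _)).
- rewrite /pcat /pact /= mE -act_seqM mulVg act_seq1.
  have /(cylP _ (trightP t))/(congr1 fst) /= <- := tx; congr pair.
  by rewrite -{1}(cyl_mkseq (trightP t) tx) -mkseqD subnKC.
- rewrite /pphi /= mE; apply: (mulIg (phis g (mkseq z k))).
  by rewrite -phisM mulVg phis1 mulVg.
- rewrite /pcat /iprefix /= zE; congr pair.
  by have /(cylP _ (tleftP t)) := act_triple_cyl tx; case/(congr1 fst).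
Qed.

Lemma ginv_germ s x (sx : cyl (tright s) x) :
  ginv (germ sx) = germ (tstar_cyl sx).
Proof.
have := grng_germ sx.
rewrite /ginv /grng; have := germ_repr (germ sx).
case: (repr _) => t y ty /= /germP H wE; apply/germP/germ_eqP => /=.
split=> //; rewrite wE; move: (H) => [/= E _].
case: _ / E sx wE H => sx wE H.
have [n [tn sn E]] := germ_eq_large H.
have tE := tres_tstar ty tn; have sE := tres_tstar sx sn.
rewrite wE E -sE in tE.
have sizeE (r : triple T) (rx : cyl (tright r) y) : (size (tright r).2 <= n)%N ->
    omap (fun q : pretriple T => size q.1.1.2) (tres r y n) =
    Some (size (tleft r).2 + (n - size (tright r).2))%N.
  by move=> rn; rewrite tresE //= size_cat size_act_seq size_mkseq.
have := sizeE _ ty tn; rewrite E (sizeE _ sx sn) => -[NE].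
by eexists; rewrite -NE in tE; exact: tE.
Qed.

Definition Theta (s : triple T) : set Gtight :=
  [set z | exists x (sx : cyl (tright s) x), z = germ sx].

(* [Theta] extended to the inverse semigroup with zero. *)
Definition Theta0 (s : SGE T) : set Gtight :=
  if s is Some t then Theta t else set0.

HB.instance Definition _ := isPointed.Build (SGE T) None.

Lemma Theta_cover : \bigcup_(s in [set: SGE T]) Theta0 s = [set: Gtight].
Proof.
apply/seteqP; split=> // z _; rewrite -(germ_repr z).
by exists (Some (pg_triple (repr z))) => //=; do 2!eexists.
Qed.

Lemma germ_restrict s u c (pc : is_path c) x z (sx : cyl (tright s) x)
  (uz : cyl (tright u) z) : cyl c x ->
  smul (Some s) (Some (tidem pc)) = Some u ->
  exists sz : cyl (tright s) z, germ sz = germ uz.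
Proof.
move=> cx uE; have [u' []] := smul_res pc cx sx.
rewrite uE => -[<-] {u'}; set n := size c.2.
case: (leqP (size (tright s).2) n) => [sn|ns]; last first.
  rewrite /tres (tright_prefix sx) pre_mul_idem leqNgt ns /= => -[].
  rewrite -(tright_prefix sx) => /val_inj us; case: _ / us uz {uE} => uz.
  by exists uz.
rewrite tresE // => -[uE'].
have uc : tright u = c.
  by rewrite /tright uE' /=; apply/cylP.
have nz : iprefix z n = c by apply/cylP => //; rewrite -uc.
have sxE : iprefix x (size (tright s).2) = tright s.
  by apply/cylP => //; exact: trightP.
have cxE : iprefix x n = c by apply/cylP.
have xz k : (k < n)%N -> x k = z k.
  move=> kn; move: cxE; rewrite -nz => -[_] /(congr1 (nth (x 0) ^~ k)).
  by rewrite !nth_mkseq.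
have szc : cyl (tright s) z.
  apply/cylP; first exact: trightP.
  rewrite -[RHS]sxE /iprefix.
  have -> : irng z = irng x by move: cxE; rewrite -nz => -[].
  congr pair; apply: (@eq_from_nth _ (x 0)); rewrite !size_mkseq // => i im.
  by rewrite !nth_mkseq // xz // (leq_trans im).
exists szc; apply/germP/germ_eqP; split=> //; exists n => /=.
have un : (size (tright u).2 <= n)%N by rewrite uc.
rewrite (tresE szc sn) (tresE uz un) uc subnn.
have eE : iprefix (shift (size (tright s).2) z) (n - size (tright s).2) =
    iprefix (shift (size (tright s).2) x) (n - size (tright s).2).
  rewrite -!ptail_iprefix // -/n nz cxE; congr ptail.
  by rewrite sxE; apply/cylP => //; exact: trightP.
by rewrite /= eE /tleft /tgrp uE' /= {2}/pcat /= cats0.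
Qed.

Lemma Theta_join (s t : SGE T) z : [set: SGE T] s -> [set: SGE T] t ->
  Theta0 s z -> Theta0 t z ->
  exists r, [/\ [set: SGE T] r, Theta0 r z & Theta0 r `<=` Theta0 s `&` Theta0 t].
Proof.
case: s t => [s|] [t|] // _ _ /= [x [sx ->]] [y [ty /germP[/= xy]]].
case: _ / xy ty => tx [c [pc [cx H]]].
have [u [uE ures]] := smul_res pc cx sx; have tE := etrans (esym H) uE.
have ux : cyl (tright u) x.
  apply/cylP; first exact: trightP.
  move: ures; rewrite /tres (tright_prefix sx) pre_mul_idem.
  case: ifP => _ [] uE'; rewrite /tright uE' /= ?size_mkseq //.
exists (Some u); split=> //=.
  exists x, ux; have [sz <-] := germ_restrict sx ux cx uE.
  by congr germ; exact: Prop_irrelevance.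
move=> _ [v [uv ->]]; split.
  by have [sv <-] := germ_restrict sx uv cx uE; exists v, sv.
by have [tv <-] := germ_restrict tx uv cx tE; exists v, tv.
Qed.

HB.instance Definition _ := isBaseTopological.Build Gtight
  Theta_cover Theta_join.

End Germs.

Local Open Scope ring_scope.

Record star_ring := StarRing {
  sring :> comPzRingType;
  conjr : {rmorphism sring -> sring};
  conjrK : involutive conjr }.

(* Not necessarily unital, as [lmodType] carries no multiplication. *)
Record star_alg (R : star_ring) := StarAlg {
  salg :> lmodType R;
  amul : salg -> salg -> salg;
  astar : salg -> salg;
  amulA : associative amul;
  amulDl : left_distributive amul +%R;
  amulDr : right_distributive amul +%R;
  scale_amull : forall r a b, r *: amul a b = amul (r *: a) b;
  scale_amulr : forall r a b, r *: amul a b = amul a (r *: b);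
  astarK : involutive astar;
  astarM : forall a b, astar (amul a b) = amul (astar b) (astar a);
  astarZD : forall r a b,
    astar (r *: a + b) = conjr R r *: astar a + astar b }.

Arguments amul {R s} _ _.
Arguments astar {R s} _.
Notation "a ** b" := (amul a b) (at level 40, left associativity) : ring_scope.
Notation "a ^#" := (astar a) (at level 2, format "a ^#") : ring_scope.

Record star_hom (R : star_ring) (A B : star_alg R) (f : A -> B) : Prop := {
  star_homZD : forall r a b, f (r *: a + b) = r *: f a + f b;
  star_homM : forall a b, f (a ** b) = f a ** f b;
  star_homJ : forall a, f a^# = (f a)^# }.

Section Families.
Variables (R : star_ring) (A : star_alg R).

Definition is_projection (p : A) : Prop := p = p^# /\ p = p ** p.
Definition is_partial_isometry (s : A) : Prop := s = s ** s^# ** s.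

Record E_family (E : graph) (P : vert E -> A) (S : edge E -> A) : Prop := {
  Efam_proj : forall v, is_projection (P v);
  Efam_orth : forall v w, v != w -> P v ** P w = 0;
  Efam_pisom : forall e, is_partial_isometry (S e);
  Efam_SS : forall e f, (S e)^# ** S f = if e == f then P (src e) else 0;
  Efam_sum : forall v, P v = \sum_(e \in [set e | rng e = v]) S e ** (S e)^# }.

Record GE_family (T : self_similar) (P : vert (gph T) -> grp T -> A)
    (S : edge (gph T) -> grp T -> A) : Prop := {
  GEfam_E : @E_family (gph T) (fun v => P v 1%g) (fun e => S e 1%g);
  GEfam_star : forall v f, (P v f)^# = P (av f^-1%g v) f^-1%g;
  GEfam_PP : forall v w f h,
    P v f ** P w h = if v == av f w then P v (f * h)%g else 0;
  GEfam_PS : forall v f e g,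
    P v f ** S e g =
      if v == rng (ae f e) then S (ae f e) (phi f e * g)%g else 0;
  GEfam_SP : forall v f e g,
    S e g ** P v f = if av g v == src e then S e (g * f)%g else 0 }.

End Families.

Section UniversalAlgebra.
Variables (R : star_ring) (T : self_similar).
Notation G := (grp T).
Notation E0 := (vert (gph T)).
Notation E1 := (edge (gph T)).

Inductive term : Type :=
  | TP of E0 & G
  | TS of E1 & G
  | TZero
  | TAdd of term & term
  | TOpp of term
  | TScale of R & term
  | TMul of term & term
  | TStar of term.

HB.instance Definition _ := gen_eqMixin term.
HB.instance Definition _ := gen_choiceMixin term.

Fixpoint eval (A : star_alg R) (P : E0 -> G -> A) (S : E1 -> G -> A)
    (t : term) : A :=
  match t with
  | TP v f => P v f
  | TS e g => S e g
  | TZero => 0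
  | TAdd t u => eval P S t + eval P S u
  | TOpp t => - eval P S t
  | TScale r t => r *: eval P S t
  | TMul t u => eval P S t ** eval P S u
  | TStar t => (eval P S t)^#
  end.

(* Two *-polynomials in the generators are identified when they agree in every
   (G,E)-family; [LGE_family] and [LGE_universal] below show that the quotient
   is the universal *-algebra generated by a (G,E)-family. *)
Definition term_eq (t u : term) : Prop :=
  forall (A : star_alg R) (P : E0 -> G -> A) (S : E1 -> G -> A),
    GE_family P S -> eval P S t = eval P S u.

Definition term_rel (t u : term) : bool := `[< term_eq t u >].

Lemma term_rel_equiv : equiv_class_of term_rel.
Proof.
split=> [t|t u|t u v]; first exact/asboolP.
  by apply/asboolP/asboolP => H A P S F; rewrite H.
move=> /asboolP tu /asboolP uv; apply/asboolP => A P S F.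
by rewrite tu // uv.
Qed.

Canonical term_equiv := EquivRelPack term_rel_equiv.

Definition LGE_sort := {eq_quot term_equiv}.
HB.instance Definition _ := Choice.on LGE_sort.
HB.instance Definition _ := Quotient.on LGE_sort.

Definition Leval (A : star_alg R) (P : E0 -> G -> A) (S : E1 -> G -> A)
  (x : LGE_sort) : A := eval P S (repr x).

Lemma Leval_pi (A : star_alg R) (P : E0 -> G -> A) (S : E1 -> G -> A) t :
  GE_family P S -> Leval P S (\pi_LGE_sort t) = eval P S t.
Proof.
move=> F; have : \pi_LGE_sort (repr (\pi_LGE_sort t)) = \pi_LGE_sort t.
  exact: reprK.
by move=> /eqmodP/asboolP; exact.
Qed.

Lemma Leval_ext (x y : LGE_sort) :
  (forall (A : star_alg R) (P : E0 -> G -> A) (S : E1 -> G -> A),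
    GE_family P S -> Leval P S x = Leval P S y) -> x = y.
Proof.
by move=> H; rewrite -[x]reprK -[y]reprK; apply/eqmodP/asboolP.
Qed.

Definition Lzero : LGE_sort := \pi_LGE_sort TZero.
Definition Ladd (x y : LGE_sort) : LGE_sort := \pi_LGE_sort (TAdd (repr x) (repr y)).
Definition Lopp (x : LGE_sort) : LGE_sort := \pi_LGE_sort (TOpp (repr x)).
Definition Lscale (r : R) (x : LGE_sort) : LGE_sort := \pi_LGE_sort (TScale r (repr x)).
Definition Lmul (x y : LGE_sort) : LGE_sort := \pi_LGE_sort (TMul (repr x) (repr y)).
Definition Lstar (x : LGE_sort) : LGE_sort := \pi_LGE_sort (TStar (repr x)).

Section LevalOps.
Variables (A : star_alg R) (P : E0 -> G -> A) (S : E1 -> G -> A).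
Hypothesis F : GE_family P S.
Local Notation ev := (Leval P S).

Lemma Leval0 : ev Lzero = 0. Proof. exact: Leval_pi. Qed.
Lemma LevalD x y : ev (Ladd x y) = ev x + ev y. Proof. exact: Leval_pi. Qed.
Lemma LevalN x : ev (Lopp x) = - ev x. Proof. exact: Leval_pi. Qed.
Lemma LevalZ r x : ev (Lscale r x) = r *: ev x. Proof. exact: Leval_pi. Qed.
Lemma LevalM x y : ev (Lmul x y) = ev x ** ev y. Proof. exact: Leval_pi. Qed.
Lemma LevalJ x : ev (Lstar x) = (ev x)^#. Proof. exact: Leval_pi. Qed.
Definition LevalE := (Leval0, LevalD, LevalN, LevalZ, LevalM, LevalJ).
End LevalOps.

Lemma LaddA : associative Ladd.
Proof. by move=> x y z; apply: Leval_ext => A P S F; rewrite !LevalE // addrA. Qed.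
Lemma LaddC : commutative Ladd.
Proof. by move=> x y; apply: Leval_ext => A P S F; rewrite !LevalE // addrC. Qed.
Lemma Ladd0 : left_id Lzero Ladd.
Proof. by move=> x; apply: Leval_ext => A P S F; rewrite !LevalE // add0r. Qed.
Lemma LaddN : left_inverse Lzero Lopp Ladd.
Proof. by move=> x; apply: Leval_ext => A P S F; rewrite !LevalE // addNr. Qed.

HB.instance Definition _ :=
  GRing.isZmodule.Build LGE_sort LaddA LaddC Ladd0 LaddN.

Lemma LevalDr (A : star_alg R) (P : E0 -> G -> A) (S : E1 -> G -> A)
    (x y : LGE_sort) :
  GE_family P S -> Leval P S (x + y) = Leval P S x + Leval P S y.
Proof. by move=> F; exact: (LevalD F). Qed.

Lemma LscaleA r s x : Lscale r (Lscale s x) = Lscale (r * s) x.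
Proof. by apply: Leval_ext => A P S F; rewrite !LevalE // scalerA. Qed.
Lemma Lscale1 : left_id 1 Lscale.
Proof. by move=> x; apply: Leval_ext => A P S F; rewrite !LevalE // scale1r. Qed.
Lemma LscaleDr : right_distributive Lscale +%R.
Proof.
move=> r x y; apply: Leval_ext => A P S F.
by rewrite LevalDr // !LevalE // ?LevalDr // scalerDr.
Qed.
Lemma LscaleDl x : {morph Lscale^~ x : r s / r + s}.
Proof.
move=> r s; apply: Leval_ext => A P S F.
by rewrite LevalDr // !LevalE // scalerDl.
Qed.

HB.instance Definition _ := GRing.Zmodule_isLmodule.Build R LGE_sort
  LscaleA Lscale1 LscaleDr LscaleDl.

Lemma LevalZr (A : star_alg R) (P : E0 -> G -> A) (S : E1 -> G -> A)
    r (x : LGE_sort) :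
  GE_family P S -> Leval P S (r *: x) = r *: Leval P S x.
Proof. by move=> F; exact: (LevalZ F). Qed.

Lemma LmulA : associative Lmul.
Proof. by move=> x y z; apply: Leval_ext => A P S F; rewrite !LevalE // amulA. Qed.
Lemma LmulDl : left_distributive Lmul +%R.
Proof.
move=> x y z; apply: Leval_ext => A P S F.
by rewrite LevalDr // !LevalE // ?LevalDr // amulDl.
Qed.
Lemma LmulDr : right_distributive Lmul +%R.
Proof.
move=> x y z; apply: Leval_ext => A P S F.
by rewrite LevalDr // !LevalE // ?LevalDr // amulDr.
Qed.
Lemma LscaleMl r (x y : LGE_sort) : r *: Lmul x y = Lmul (r *: x) y.
Proof.
apply: Leval_ext => A P S F.
by rewrite LevalZr // !LevalE // ?LevalZr // scale_amull.
Qed.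
Lemma LscaleMr r (x y : LGE_sort) : r *: Lmul x y = Lmul x (r *: y).
Proof.
apply: Leval_ext => A P S F.
by rewrite LevalZr // !LevalE // ?LevalZr // scale_amulr.
Qed.
Lemma LstarK : involutive Lstar.
Proof. by move=> x; apply: Leval_ext => A P S F; rewrite !LevalE // astarK. Qed.
Lemma LstarM (x y : LGE_sort) : Lstar (Lmul x y) = Lmul (Lstar y) (Lstar x).
Proof. by apply: Leval_ext => A P S F; rewrite !LevalE // astarM. Qed.
Lemma LstarZD r (x y : LGE_sort) :
  Lstar (r *: x + y) = conjr R r *: Lstar x + Lstar y.
Proof.
apply: Leval_ext => A P S F.
by rewrite LevalDr // LevalZr // !LevalE // ?LevalDr // ?LevalZr // astarZD.
Qed.

Definition LGE : star_alg R := StarAlg LmulA LmulDl LmulDr LscaleMl LscaleMr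
  LstarK LstarM LstarZD.

Definition Lp (v : E0) (f : G) : LGE := \pi_LGE_sort (TP v f).
Definition Ls (e : E1) (g : G) : LGE := \pi_LGE_sort (TS e g).

Lemma Leval_hom (A : star_alg R) (P : E0 -> G -> A) (S : E1 -> G -> A) :
  GE_family P S -> star_hom (Leval P S : LGE -> A).
Proof.
move=> F; split=> [r a b|a b|a].
- by rewrite LevalDr // LevalZr.
- exact: (LevalM F).
- exact: (LevalJ F).
Qed.

Lemma LevalMr (A : star_alg R) (P : E0 -> G -> A) (S : E1 -> G -> A)
  (a b : LGE) : GE_family P S -> Leval P S (a ** b) = Leval P S a ** Leval P S b.
Proof. by move=> F; exact: (LevalM F). Qed.

Lemma LevalJr (A : star_alg R) (P : E0 -> G -> A) (S : E1 -> G -> A) (a : LGE) :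
  GE_family P S -> Leval P S a^# = (Leval P S a)^#.
Proof. by move=> F; exact: (LevalJ F). Qed.

Lemma Leval_p (A : star_alg R) (P : E0 -> G -> A) (S : E1 -> G -> A) v f :
  GE_family P S -> Leval P S (Lp v f) = P v f.
Proof. exact: Leval_pi. Qed.

Lemma Leval_s (A : star_alg R) (P : E0 -> G -> A) (S : E1 -> G -> A) e g :
  GE_family P S -> Leval P S (Ls e g) = S e g.
Proof. exact: Leval_pi. Qed.

Lemma Leval_if (A : star_alg R) (P : E0 -> G -> A) (S : E1 -> G -> A)
    (b : bool) (x : LGE) :
  GE_family P S ->
  Leval P S (if b then x else 0) = if b then Leval P S x else 0.
Proof. by move=> F; case: b => //; exact: Leval0. Qed.

Lemma LGE_family : GE_family Lp Ls.
Proof.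
split.
- split.
  + move=> v; split; apply: Leval_ext => A P S F; have EF := GEfam_E F;
      have [pJ pp] := Efam_proj EF v.
    * by rewrite LevalJr // Leval_p.
    * by rewrite LevalMr // Leval_p.
  + move=> v w vw; apply: Leval_ext => A P S F.
    rewrite LevalMr // !Leval_p // Leval0 //.
    exact: (Efam_orth (GEfam_E F)).
  + move=> e; apply: Leval_ext => A P S F.
    rewrite !LevalMr // LevalJr // Leval_s //.
    exact: (Efam_pisom (GEfam_E F)).
  + move=> e f; apply: Leval_ext => A P S F.
    rewrite Leval_if // LevalMr // LevalJr // !Leval_s // Leval_p //.
    exact: (Efam_SS (GEfam_E F)).
  + move=> v; apply: Leval_ext => A P S F.
    rewrite Leval_p // (Efam_sum (GEfam_E F) v).
    rewrite !fsbig_finite; try exact: gph_row_finite.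
    rewrite (big_morph _ (LevalD F) (Leval0 F)); apply: eq_bigr => e _.
    by rewrite LevalMr // LevalJr // Leval_s.
- move=> v f; apply: Leval_ext => A P S F.
  by rewrite LevalJr // !Leval_p // (GEfam_star F).
- move=> v w f h; apply: Leval_ext => A P S F.
  by rewrite Leval_if // LevalMr // !Leval_p // (GEfam_PP F).
- move=> v f e g; apply: Leval_ext => A P S F.
  rewrite Leval_if // LevalMr // Leval_p // !Leval_s //.
  exact: (GEfam_PS F).
- move=> v f e g; apply: Leval_ext => A P S F.
  rewrite Leval_if // LevalMr // Leval_p // !Leval_s //.
  exact: (GEfam_SP F).
Qed.

Lemma LGE_ind (K : LGE -> Prop) :
  (forall v f, K (Lp v f)) -> (forall e g, K (Ls e g)) ->
  (forall r a b, K a -> K b -> K (r *: a + b)) ->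
  (forall a b, K a -> K b -> K (a ** b)) ->
  (forall a, K a -> K a^#) -> K 0 -> forall a, K a.
Proof.
move=> Kp Ks KZD KM KJ K0 a; rewrite -[a](@reprK _ LGE_sort).
have piE (t u : LGE) :
    (forall (A : star_alg R) (P : E0 -> G -> A) (S : E1 -> G -> A),
       GE_family P S -> Leval P S t = Leval P S u) -> K t -> K u.
  by move=> /Leval_ext ->.
elim: (repr a) => [v f|e g||t Kt u Ku|t Kt|r t Kt|t Kt u Ku|t Kt].
- exact: Kp.
- exact: Ks.
- exact: K0.
- apply: piE (KZD 1 _ _ Kt Ku) => A P S F.
  by rewrite LevalDr // LevalZr // !Leval_pi // scale1r.
- apply: piE (KZD (- 1) _ _ Kt K0) => A P S F.
  by rewrite LevalDr // LevalZr // Leval0 // !Leval_pi //= scaleN1r addr0.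
- apply: piE (KZD r _ _ Kt K0) => A P S F.
  by rewrite LevalDr // LevalZr // Leval0 // !Leval_pi //= addr0.
- apply: piE (KM _ _ Kt Ku) => A P S F.
  by rewrite LevalMr // !Leval_pi.
- apply: piE (KJ _ Kt) => A P S F.
  by rewrite LevalJr // !Leval_pi.
Qed.

Lemma LGE_universal (A : star_alg R) (P : E0 -> G -> A) (S : E1 -> G -> A) :
  GE_family P S ->
  exists! h : LGE -> A, [/\ star_hom h, forall v f, h (Lp v f) = P v f
    & forall e g, h (Ls e g) = S e g].
Proof.
move=> F; exists (Leval P S); split.
  split; [exact: Leval_hom|by move=> *; exact: Leval_p|
          by move=> *; exact: Leval_s].
move=> h [hh hp hs]; have eh := Leval_hom F; apply: funext.
have z0 (k : LGE -> A) : star_hom k -> k 0 = 0.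
  move=> kh; have := star_homZD kh (-1) 0 0.
  by rewrite scaler0 addr0 scaleN1r addNr.
apply: LGE_ind => [v f|e g|r a b Ha Hb|a b Ha Hb|a Ha|].
- by rewrite Leval_p.
- by rewrite Leval_s.
- by rewrite (star_homZD eh) (star_homZD hh) Ha Hb.
- by rewrite (star_homM eh) (star_homM hh) Ha Hb.
- by rewrite (star_homJ eh) (star_homJ hh) Ha.
- by rewrite !z0.
Qed.

End UniversalAlgebra.

Section Steinberg.
Variables (R : star_ring) (T : self_similar).

(* For an open set, injectivity of the source and range maps makes them
   homeomorphisms onto open sets, as both are local homeomorphisms. *)
Definition compact_open_bisection (B : set (Gtight T)) : Prop :=
  [/\ compact B, open B, set_inj B (@gsrc T) & set_inj B (@grng T)].

Definition steinberg : set (Gtight T -> R) :=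
  [set f | exists n (c : 'I_n -> R) (B : 'I_n -> set (Gtight T)),
    (forall i, compact_open_bisection (B i)) /\
    forall z, f z = \sum_(i < n) c i * \1_(B i) z].

(* The sum is over the factorisations of [z] where the summand is nonzero;
   there are finitely many of them for [f] and [g] in [steinberg]. *)
Definition conv (f g : Gtight T -> R) : Gtight T -> R := fun z =>
  \sum_(p \in [set p : Gtight T * Gtight T | gmul p.1 p.2 z]) f p.1 * g p.2.

Definition fstar (f : Gtight T -> R) : Gtight T -> R :=
  fun z => conjr R (f (ginv z)).

Record steinberg_hom (A : star_alg R) (h : A -> Gtight T -> R) : Prop := {
  steinberg_homP : forall a, steinberg (h a);
  steinberg_homZD : forall r a b z, h (r *: a + b) z = r * h a z + h b z;
  steinberg_homM : forall a b, h (a ** b) = conv (h a) (h b);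
  steinberg_homJ : forall a, h a^# = fstar (h a) }.

Definition is_piGE (h : LGE R T -> Gtight T -> R) : Prop :=
  [/\ steinberg_hom h,
      forall v (f : grp T), h (Lp R v f) = \1_(Theta (vtriple v f))
    & forall e (g : grp T), h (Ls R e g) = \1_(Theta (etriple e g))].

End Steinberg.

Arguments steinberg R T _ : clear implicits.

(* Main.v *)
Require Import Defs.
From HB Require Import structures.
From mathcomp Require Import all_boot all_order all_algebra.
From mathcomp Require Import finmap zify.
From mathcomp Require Import all_classical topology numfun.

(** In any (G,E)-family the elements [tau (a, g, b) = s_a p_(s(a), g) s_b^*]
    multiply like the triples of the inverse semigroup, so they span [LGE], and
    [pi] sends [tau s] to the indicator of [Theta s].

    Surjectivity: a compact open bisection is a finite union of sets [Theta s],
    and inside a bisection two of these are nested or disjoint.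

    Injectivity: let [pi] kill [a = sum_i r_i tau(s_i)] and let [x] be an
    infinite path. For a long prefix [c] of [x], the products [s_i (c, 1, c)]
    depend only on the germs of the [s_i] at [x], and the [r_i] belonging to one
    germ sum to the value of [pi a] there, which is 0. So [a tau(c, 1, c) = 0].
    As [tau(c, 1, c)] is the sum of the [tau(ce, 1, ce)] over the edges [e] that
    extend [c], a path on which [a tau(c, 1, c)] does not vanish could be
    extended to an infinite one on which it never vanishes (Koenig). Hence
    [a p_v = 0] for all vertices [v], and [a] is a finite sum of such [a p_v]. *)

Set Implicit Arguments.
Unset Strict Implicit.
Unset Printing Implicit Defensive.

Import GRing.Theory.

Local Open Scope classical_set_scope.
Local Open Scope quotient_scope.

Local Notation tval := Defs.tval (only parsing).

(** * Germs and products of triples, compared over long prefixes *)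

Section Groupoid.
Local Open Scope group_scope.
Variable T : self_similar.
Notation G := (grp T).
Implicit Types (x y : ipath T) (a b c d : prepath T) (s t u : triple T).
Implicit Types (z w v : Gtight T).

Lemma iprefixD x m k : iprefix x (m + k) = pcat (iprefix x m) (iprefix (shift m
  x) k).
Proof. by rewrite /iprefix /pcat /= mkseqD. Qed.

Lemma iprefix_iact g x n : iprefix (iact g x) n = pact g (iprefix x n).
Proof. by rewrite /iprefix irng_iact mkseq_iact. Qed.

Lemma phis_inv g (q : seq (edge (gph T))) :
  phis g (act_seq g^-1 q) = (phis g^-1 q)^-1.
Proof.
by apply: (mulIg (phis g^-1 q)); rewrite -phisM mulgV phis1 mulVg.
Qed.

(** Restricting [t] to a prefix of [x] keeps its germ at [x]: a second product with the idempotent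
    of the same prefix changes nothing. *)
Lemma tres_rep t x n r : cyl (tright t) x -> tres t x n = Some r ->
  exists u (ux : cyl (tright u) x) (tx : cyl (tright t) x),
    tval u = r /\ germ tx = germ ux.
Proof.
move=> tx tE.
have rP : is_triple r.
  exact: (pre_mul_triple (tvalP t) (idem_triple (is_path_iprefix x n)) tE).
have rR : cyl (tright (Triple rP)) x.
  apply/cylP; first exact: trightP.
  move: tE; rewrite /tres (tright_prefix tx) pre_mul_idem /tright /=.
  by case: ifP => _ -[<-] /=; rewrite size_mkseq.
exists (Triple rP), rR, tx; split=> //; apply/germP/germ_eqP; split=> //=.
exists n; rewrite tE /tres /=; move: tE.
rewrite /tres (tright_prefix tx) pre_mul_idem => -[<-].
case: ifP => nn; last by rewrite pre_mul_idem nn.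
by rewrite pre_mul_idem leqnn subnn /pcat /= cats0.
Qed.

Lemma germ_irr s x (p q : cyl (tright s) x) : germ p = germ q.
Proof. by congr germ; exact: Prop_irrelevance. Qed.

Lemma germ_triple_eq s t x (sx : cyl (tright s) x) (tx : cyl (tright t) x) :
  tval s = tval t -> germ sx = germ tx.
Proof. by move/val_inj => st; case: _ / st tx => tx; exact: germ_irr. Qed.

(* For large [n] this does not depend on the representative: it is the triple
   with right entry the prefix of length [n] of the source of [z] that
   represents [z]. *)
Definition gdata z n : option (pretriple T) :=
  tres (pg_triple (repr z)) (gsrc z) n.

(** Two representatives of a germ agree after restriction to some prefix, hence after restriction to
    every longer one. *)
Lemma gdata_germ t x (tx : cyl (tright t) x) :
  exists N, forall n, (N <= n)%N -> gdata (germ tx) n = tres t x n.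
Proof.
rewrite /gdata gsrc_germ; have := germ_repr (germ tx).
case: (repr _) => s y sy /= /germP/germ_eqP[/= yx [N NE]].
case: _ / yx tx NE => tx NE; exists N => n Nn; exact: tresW Nn NE.
Qed.

Lemma gdata_inj z w n r : gsrc z = gsrc w ->
  gdata z n = Some r -> gdata w n = Some r -> z = w.
Proof.
rewrite /gdata /gsrc => zw.
move=> /(tres_rep (pg_cyl (repr z))) [s [sx [zx [sr zE]]]].
move=> /(tres_rep (pg_cyl (repr w))) [t [tx [wx [tr wE]]]].
rewrite -(germ_repr z) -(germ_repr w) (germ_irr _ zx) (germ_irr _ wx) zE wE.
case: _ / zw tx {wx wE} => tx.
by apply: germ_triple_eq; rewrite sr tr.
Qed.

Lemma gdata_rep z x n a g b : gsrc z = x -> gdata z n = Some (a, g, b) ->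
  exists t (tx : cyl (tright t) x), tval t = (a, g, b) /\ germ tx = z.
Proof.
move=> <-; rewrite /gdata => /(tres_rep (pg_cyl (repr z))) [s [sx [zx [sr zE]]]].
exists s, sx; split=> //; rewrite -zE -[RHS]germ_repr; exact: germ_irr.
Qed.

Lemma pprefix_common c b y : is_path b -> is_path c -> cyl b y -> cyl c y ->
  pprefix b c || pprefix c b.
Proof.
move=> pb pc /(cylP _ pb) bE /(cylP _ pc) cE.
by rewrite -bE -cE !pprefix_iprefix leq_total.
Qed.

Lemma cyl_pcat b e x : is_path (pcat b e) ->
  cyl (pcat b e) x <-> cyl b x /\ mkseq (shift (size b.2) x) (size e.2) = e.2.
Proof.
move=> pbe.
have pb : is_path b by move: pbe; rewrite /is_path composable_cat => /andP[].
split.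
  move=> /(cylP _ pbe) E.
  have bb : iprefix x (size b.2) = b.
    case: (b) (e) E => bv bs [ev es] /=.
    rewrite size_cat /iprefix mkseqD => -[-> /eqP].
    by rewrite eqseq_cat ?size_mkseq // => /andP[/eqP ->].
  split; first exact/cylP.
  move: E; rewrite size_cat iprefixD bb /pcat /= => -[/eqP].
  by rewrite eqseq_cat // => /andP[_ /eqP].
move=> [/(cylP _ pb) bE eE]; apply/cylP => //.
by rewrite size_cat iprefixD bE /pcat /= eE.
Qed.

Lemma smulE s t u : smul (Some s) (Some t) = Some u <->
  pre_mul (tval s) (tval t) = Some (tval u).
Proof.
rewrite /= /triple_mul; split.
  case E : (pre_mul _ _) => [r|] //=.
  by case: insubP => //= r' rP rE [<-]; rewrite rE.
by move=> -> /=; rewrite valK.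
Qed.

Lemma smul_None s t : pre_mul (tval s) (tval t) = None ->
  smul (Some s) (Some t) = None.
Proof. by rewrite /= /triple_mul => ->. Qed.

Lemma pre_mul_Some s t r : pre_mul (tval s) (tval t) = Some r ->
  exists2 u, tval u = r & smul (Some s) (Some t) = Some u.
Proof.
move=> E; have rP := pre_mul_triple (tvalP s) (tvalP t) E.
by exists (Triple rP) => //; apply/smulE.
Qed.

(** The remainder [e] enters through an equation between paths, so that products can be computed
    without [ptail]. *)
Lemma smul_cases s t :
     (exists e, tleft t = pcat (tright s) e /\
        pre_mul (tval s) (tval t) =
          Some (pcat (tleft s) (pact (tgrp s) e), pphi (tgrp s) e * tgrp t,
            tright t))
  \/ (exists e, tright s = pcat (tleft t) e /\
        pre_mul (tval s) (tval t) =
          Some (tleft s, tgrp s * (pphi (tgrp t)^-1 e)^-1,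
                pcat (tright t) (pact (tgrp t)^-1 e)))
  \/ [/\ ~~ pprefix (tright s) (tleft t), ~~ pprefix (tleft t) (tright s)
       & pre_mul (tval s) (tval t) = None].
Proof.
rewrite (triple_eta s) (triple_eta t) /pre_mul.
rewrite -[tleft (tval s)]/(tleft s).
case: ifP => [bc|bc]; first by left; exists (ptail (tright s) (tleft t));
  rewrite pcat_ptail.
case: ifP => [cb|cb]; last by right; right.
by right; left; exists (ptail (tleft t) (tright s)); rewrite pcat_ptail.
Qed.

(** If the right path of [s] is the longer one, with remainder [e], then [u] requires [h^-1 . e]
    after the right path of [t], and the group element [h] of [t] carries this piece to [e].
    Together with [smul_def] this identifies the domain of a product with the domain of the
    composite map. *)
Lemma smul_cyl s t u x : smul (Some s) (Some t) = Some u -> cyl (tright u) x ->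
  exists tx : cyl (tright t) x, cyl (tright s) (act_triple tx).
Proof.
move=> /smulE uE ux; have pu := trightP u.
have [[e [te]]|[[e [se]]|[_ _]]] := smul_cases s t; rewrite {}uE //.
  move=> [E]; have tu : tright u = tright t by rewrite /tright E.
  rewrite tu in ux; exists ux; have := act_triple_cyl ux; rewrite te.
  have pt := tleftP t; rewrite te in pt.
  by case/(cyl_pcat _ pt).
move=> [E]; have uR : tright u = pcat (tright t) (pact (tgrp t)^-1 e).
  by rewrite {1}/tright E.
rewrite uR in ux pu; have [tx /= sE] := (cyl_pcat _ pu).1 ux.
rewrite size_act_seq in sE.
exists tx; have ps := trightP s; rewrite se in ps *; apply/cyl_pcat => //.
split; first exact: act_triple_cyl.
by rewrite shift_act_triple mkseq_iact sE -act_seqM mulgV act_seq1.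
Qed.

Lemma smul_def s t x (tx : cyl (tright t) x) : cyl (tright s) (act_triple tx) ->
  exists2 u, smul (Some s) (Some t) = Some u & cyl (tright u) x.
Proof.
move=> sx.
have [[e [te E]]|[[e [se E]]|[n1 n2 _]]] := smul_cases s t; last first.
- have := pprefix_common (trightP s) (tleftP t) sx (act_triple_cyl tx).
  by rewrite (negbTE n1) (negbTE n2).
- have [u uE sE] := pre_mul_Some E; exists u => //.
  have uR : tright u = pcat (tright t) (pact (tgrp t)^-1 e) by rewrite
    {1}/tright uE.
  have pu := trightP u; rewrite uR in pu *; apply/cyl_pcat => //; split=> //.
  have ps := trightP s; rewrite se in ps sx.
  have [_] := (cyl_pcat _ ps).1 sx.
  rewrite shift_act_triple mkseq_iact /= size_act_seq => eE.
  by rewrite -[in RHS]eE -act_seqM mulVg act_seq1.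
- have [u uE sE] := pre_mul_Some E; exists u => //.
  by rewrite /tright uE.
Qed.

(** Over a long prefix of [x] both factors share a middle path [c], and the product only multiplies
    the group elements. This reduces laws for germs to laws of [G]. *)
Lemma smul_tres s t u x (tx : cyl (tright t) x) (sx :
  cyl (tright s) (act_triple tx)) :
  smul (Some s) (Some t) = Some u ->
  exists N, forall n, (N <= n)%N -> exists a g c h,
    [/\ tres t x n = Some (c, h, iprefix x n),
        tres s (act_triple tx) (size c.2) = Some (a, g, c)
      & tres u x n = Some (a, g * h, iprefix x n)].
Proof.
move=> sE; have [u' sE' ux] := smul_def sx; move: sE'; rewrite sE => -[uu].
rewrite -{u'}uu in ux; move/smulE: sE => uE.
(* Long enough for [tresE] to apply to [t] and [u] at [x], and to [s] at the image of [x] under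
   [t]. *)
exists (size (tright t).2 + size (tright s).2 + size (tright u).2)%N => n Nn.
have tn : (size (tright t).2 <= n)%N by lia.
have un : (size (tright u).2 <= n)%N by lia.
have [k nk] : exists k, n = (size (tright t).2 + k)%N.
  by exists (n - size (tright t).2)%N; lia.
have sk : (size (tright s).2 <= k)%N by lia.
rewrite !tresE // nk addKn /=.
set x' := shift _ x; set h := tgrp t; set c := tleft t.
have sc : size (pcat c (pact h (iprefix x' k))).2 = (size c.2 + k)%N.
  by rewrite /= size_cat size_act_seq size_mkseq.
have cy : iprefix (act_triple tx) (size c.2) = c.
  by apply/cylP; [exact: tleftP | exact: act_triple_cyl].
have yE : iprefix (act_triple tx) (size c.2 + k) = pcat c (pact h (iprefix x' k)).
  by rewrite iprefixD shift_act_triple cy iprefix_iact.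
do 4!eexists; split; first by [].
  rewrite -[size (_ ++ _)]/(size (pcat c (pact h (iprefix x' k))).2) sc.
  rewrite tresE ?yE //; lia.
have [[e [te E]]|[[e [se E]]|[_ _ E]]] := smul_cases s t; move: uE;
  rewrite E // => -[uE].
- have -> : tright u = tright t by rewrite /tright -uE.
  rewrite addKn -/x'.
  have -> : tleft u = pcat (tleft s) (pact (tgrp s) e) by rewrite /tleft -uE.
  have -> : tgrp u = pphi (tgrp s) e * h by rewrite /tgrp -uE.
  have -> : (size c.2 + k - size (tright s).2 = size e.2 + k)%N.
    by rewrite /c te /= size_cat; lia.
  have ec : mkseq (shift (size (tright s).2) (act_triple tx)) (size e.2 + k) =
            e.2 ++ act_seq h (mkseq x' k).
    rewrite mkseqD shift_shift.
    have -> : (size (tright s).2 + size e.2 = size c.2)%N by rewrite /c te /=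
      size_cat.
    rewrite shift_act_triple mkseq_iact; congr (_ ++ _).
    have pc := tleftP t; have := act_triple_cyl tx; rewrite te in pc *.
    by case/(cyl_pcat _ pc).
  congr (Some (_, _, _)); rewrite /pcat /pact /pphi /= ec.
    by rewrite act_seq_cat catA act_seqM.
  by rewrite phis_cat phisM.
- have uR : tright u = pcat (tright t) (pact h^-1 e) by rewrite {1}/tright -uE.
  have -> : tleft u = tleft s by rewrite /tleft -uE.
  have -> : tgrp u = tgrp s * (pphi h^-1 e)^-1 by rewrite {1}/tgrp -uE.
  have ek : (size e.2 <= k)%N by rewrite se /= size_cat in sk; lia.
  have -> : (size (tright t).2 + k - size (tright u).2 = k - size e.2)%N.
    by rewrite uR /= size_cat size_act_seq; lia.
  have -> : (size c.2 + k - size (tright s).2 = k - size e.2)%N.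
    by rewrite se /= size_cat -/c; lia.
  have xe : mkseq x' (size e.2) = act_seq h^-1 e.2.
    have pu := trightP u; rewrite uR in pu ux.
    by case/(cyl_pcat _ pu): ux => _ /=; rewrite size_act_seq.
  have x'E : mkseq x' k = act_seq h^-1 e.2 ++ mkseq (shift (size e.2) x') (k -
    size e.2).
    by rewrite -[in LHS](subnKC ek) mkseqD xe.
  have -> : shift (size (tright u).2) x = shift (size e.2) x'.
    by rewrite uR /= size_cat size_act_seq shift_shift.
  rewrite /pcat /pact /pphi /=.
  have -> : mkseq (shift (size (tright s).2) (act_triple tx)) (k - size e.2) =
    act_seq (phis h^-1 e.2)^-1 (mkseq (shift (size e.2) x') (k - size e.2)).
    have -> : size (tright s).2 = (size c.2 + size e.2)%N by rewrite se /=
      size_cat.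
    rewrite -shift_shift shift_act_triple -/x'.
    (* Acting by [h] and then dropping a prefix amounts to dropping it first and acting by the
       cocycle of [h] at that prefix. *)
    have -> : shift (size e.2) (iact h x') = iact (phis h (mkseq x' (size
      e.2))) (shift (size e.2) x').
      apply: ipath_inj => j.
      by rewrite -[LHS]/(ae (phis h (mkseq x' (size e.2 + j))) _) mkseqD phis_cat.
    by rewrite mkseq_iact xe phis_inv.
  congr (Some (_, _, _)).
    by rewrite act_seqM.
  by rewrite x'E phis_cat phis_inv -phisM.
Qed.
End Groupoid.

(** * Laws of the groupoid of germs and of the sets [Theta s] *)

Section GroupoidLaws.
Local Open Scope group_scope.
Variable T : self_similar.
Notation G := (grp T).
Implicit Types (x y : ipath T) (a b c d : prepath T) (s t u : triple T).
Implicit Types (z w v : Gtight T).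

Lemma iactM g h x : iact (g * h) x = iact g (iact h x).
Proof.
apply: ipath_inj => j.
by rewrite -[LHS]/(ae (phis (g * h) (mkseq x j)) (x j)) phisM acteM -mkseq_iact.
Qed.

Lemma iact1 x : iact 1 x = x.
Proof. by apply: ipath_inj => j /=; rewrite phis1 acte1. Qed.

Lemma gmul_src z w v : gmul z w v -> gsrc z = grng w /\ gsrc v = gsrc w.
Proof.
by move=> [s [t [u [x [tx [sx [ux [_ -> -> ->]]]]]]]];
  rewrite !gsrc_germ grng_germ.
Qed.

(** The last bound says that the middle path [c] grows with [n]. Associativity needs it in order to
    apply the lemma a second time, at the length of a middle path. *)
Lemma gmul_gdata z w v : gmul z w v ->
  exists N, forall n, (N <= n)%N -> exists a g c h,
    [/\ gdata w n = Some (c, h, iprefix (gsrc w) n),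
        gdata z (size c.2) = Some (a, g, c),
        gdata v n = Some (a, g * h, iprefix (gsrc w) n)
      & (n <= size c.2 + N)%N].
Proof.
move=> [s [t [u [x [tx [sx [ux [sE -> -> ->]]]]]]]].
have [N1 H1] := gdata_germ tx; have [N2 H2] := gdata_germ sx.
have [N3 H3] := gdata_germ ux; have [N4 H4] := smul_tres sx sE.
exists (N1 + N2 + N3 + N4 + size (tright t).2)%N => n Nn.
have [a [g [c [h [tE sE' uE]]]]] := H4 n ltac:(lia).
have nc : (n <= size c.2 + size (tright t).2)%N.
  move: (tE); rewrite tresE //; last lia.
  by move=> [<- _] /=; rewrite size_cat size_act_seq size_mkseq; lia.
exists a, g, c, h; split.
- by rewrite H1 ?gsrc_germ //; lia.
- by rewrite H2 //; lia.
- by rewrite H3 ?gsrc_germ //; lia.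
- lia.
Qed.

(** A single length suffices: the data provide representatives with a common middle path, and the
    tails in their product are empty. *)
Lemma gdata_gmul z w v n a g c h : gsrc z = grng w -> gsrc v = gsrc w ->
  gdata w n = Some (c, h, iprefix (gsrc w) n) ->
  gdata z (size c.2) = Some (a, g, c) ->
  gdata v n = Some (a, g * h, iprefix (gsrc w) n) -> gmul z w v.
Proof.
move=> zw vw /(gdata_rep (erefl _)) [t [tx [tE wE]]].
have wr : grng w = act_triple tx by rewrite -(grng_germ tx) wE.
move=> /(gdata_rep (etrans zw wr)) [s [sx [sE zE]]] /(gdata_rep vw) [u [ux [uE
  vE]]].
exists s, t, u, (gsrc w), tx, sx, ux; split=> //; apply/smulE.
rewrite sE tE uE /pre_mul pprefix_refl /ptail drop_size.
by rewrite /pcat /pact /pphi /= cats0; case: (a).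
Qed.

(** The definition of [gmul] only asks for some representatives; the data at one length that is
    large for both products show that the choice does not matter. *)
Lemma gmul_fun z w v v' : gmul z w v -> gmul z w v' -> v = v'.
Proof.
move=> H H'; have [_ vw] := gmul_src H; have [_ vw'] := gmul_src H'.
have [N1 H1] := gmul_gdata H; have [N2 H2] := gmul_gdata H'.
have [a [g [c [h [wE zE vE _]]]]] := H1 (N1 + N2)%N ltac:(lia).
have [a' [g' [c' [h' [wE' zE' vE' _]]]]] := H2 (N1 + N2)%N ltac:(lia).
move: wE'; rewrite wE => -[cc hh]; rewrite -{c'}cc -{h'}hh in zE' vE'.
move: zE'; rewrite zE => -[aa gg]; rewrite -{a'}aa -{g'}gg in vE'.
by apply: gdata_inj vE vE'; rewrite vw vw'.
Qed.

Lemma gmul_ex z w : gsrc z = grng w -> exists v, gmul z w v.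
Proof.
move=> zw.
have := germ_repr z; have := germ_repr w; case: (repr w) => t x tx.
case: (repr z) => s y sy /= wE zE; move: zw.
rewrite -wE -zE gsrc_germ grng_germ => yE.
case: _ / (esym yE) sy zE => sx zE; have [u uE ux] := smul_def sx.
by exists (germ ux), s, t, u, x, tx, sx, ux.
Qed.

Lemma gmul_rng z w v : gmul z w v -> grng v = grng z.
Proof.
move=> H; have [zw vw] := gmul_src H; have [N /(_ N (leqnn N))] := gmul_gdata H.
move=> [a [g [c [h [wE zE vE _]]]]].
have [t [tx [tE w_]]] := gdata_rep (erefl _) wE;
  have [s [sx [sE z_]]] := gdata_rep (erefl _) zE.
have [u [ux [uE v_]]] := gdata_rep (erefl _) vE.
rewrite -v_ -z_ !grng_germ; apply: ipath_inj => k.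
rewrite -[LHS]/(icat (tleft u).2 (iact (tgrp u) (shift (size (tright u).2)
  (gsrc v))) k).
rewrite -[RHS]/(icat (tleft s).2 (iact (tgrp s) (shift (size (tright s).2)
  (gsrc z))) k).
have -> : tleft u = a by rewrite /tleft uE.
have -> : tleft s = a by rewrite /tleft sE.
have -> : tgrp u = g * h by rewrite /tgrp uE.
have -> : tgrp s = g by rewrite /tgrp sE.
have -> : tright u = iprefix (gsrc w) N by rewrite {1}/tright uE.
have -> : tright s = c by rewrite {1}/tright sE.
(* Since [z] starts where [w] ends, its tail is [h] applied to the tail of the source of [w]; so [g]
   acts on the former as [g * h] does on the latter. *)
have -> : shift (size c.2) (gsrc z) = iact h (shift N (gsrc w)).
  rewrite zw -w_ grng_germ.
  have <- : tleft t = c by rewrite /tleft tE.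
  rewrite shift_act_triple w_.
  have -> : tgrp t = h by rewrite /tgrp tE.
  have -> : tright t = iprefix (gsrc w) N by rewrite {1}/tright tE.
  by rewrite size_mkseq.
by rewrite vw size_mkseq iactM.
Qed.

(** The data of the two bracketings have the same outer paths, and their group elements differ only
    by the associativity law of [G]. *)
Lemma gmulA z w v (y k : Gtight T) : gmul z w v -> gmul v y k ->
  exists2 m, gmul w y m & gmul z m k.
Proof.
move=> H1 H2; have [zw vw] := gmul_src H1; have [vy ky] := gmul_src H2.
have [m H3] : exists m, gmul w y m by apply: gmul_ex; rewrite -vw.
exists m => //; have [wy my] := gmul_src H3.
have [N1 D1] := gmul_gdata H1; have [N2 D2] := gmul_gdata H2.
have [N3 D3] := gmul_gdata H3.
have [a2 [g2 [c2 [h2 [yE vE kE nc2]]]]] := D2 (N1 + N2 + N3)%N ltac:(lia).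
(* This length is the one at which [vE] reads [v], so that the two descriptions of [v] can be
   compared; [nc2] ensures that it is large enough. *)
have [a1 [g1 [c1 [h1 [wE zE vE' _]]]]] := D1 (size c2.2) ltac:(lia).
have [a3 [g3 [c3 [h3 [yE' wE' mE _]]]]] := D3 (N1 + N2 + N3)%N ltac:(lia).
move: yE'; rewrite yE => -[cc hh]; rewrite -{c3}cc -{h3}hh in wE' mE.
move: wE'; rewrite wE => -[cc hh _]; rewrite -{a3}cc -{g3}hh in mE.
move: vE'; rewrite vE => -[aa gg _]; rewrite {a2}aa {g2}gg in kE vE.
rewrite -my -mulgA in kE.
rewrite -my in mE.
apply: (gdata_gmul (z := z) (w := m)) mE zE kE; last by rewrite ky my.
by rewrite zw (gmul_rng H3).
Qed.

Lemma Theta_germ s x (sx : cyl (tright s) x) : Theta s (germ sx).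
Proof. by exists x, sx. Qed.

Lemma Theta_src_inj s : set_inj (Theta s) (@gsrc T).
Proof.
move=> z w /set_mem [x [sx ->]] /set_mem [y [sy ->]]; rewrite !gsrc_germ => E.
by case: _ / E sy => sy; exact: germ_irr.
Qed.

(** One inclusion is [smul_cyl], the other combines [smul_def] with the uniqueness of products of
    germs. The convolution of indicators rests on this. *)
Lemma Theta0_mul (s t : SGE T) v : Theta0 (smul s t) v <->
  exists z w, [/\ Theta0 s z, Theta0 t w & gmul z w v].
Proof.
case: s t => [s|] [t|]; last 3 first.
- by split=> // -[z [w []]].
- by split=> // -[z [w []]].
- by split=> // -[z [w []]].
split.
  case E : (smul _ _) => [u|] // -[x [ux ->]].
  have [tx sx] := smul_cyl E ux; exists (germ sx), (germ tx).
  by split; [exact: Theta_germ | exact: Theta_germ | exists s, t, u, x, tx, sx,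
    ux].
move=> [z [w [/= [y [sy ->]] [x [tx ->]] H]]].
have [yE _] := gmul_src H; move: yE; rewrite gsrc_germ grng_germ => yE.
case: _ / (esym yE) sy H => sx H; have [u uE ux] := smul_def sx.
rewrite (gmul_fun H (v' := germ ux)); last by exists s, t, u, x, tx, sx, ux.
by move: uE; rewrite /= => ->; exists x, ux.
Qed.

(** Associativity is transported from germs to the sets [Theta], which avoids comparing nested
    prefix cases of [pre_mul]; convolution sees triples only through these sets. *)
Lemma Theta0_mulA (s t u : SGE T) :
  Theta0 (smul (smul s t) u) = Theta0 (smul s (smul t u)).
Proof.
apply/seteqP; split=> k.
  move/Theta0_mul => [v [y [/Theta0_mul[z [w [sz tw H1]]] uy H2]]].
  have [m H3 H4] := gmulA H1 H2; apply/Theta0_mul; exists z, m; split=> //.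
  by apply/Theta0_mul; exists w, y.
move/Theta0_mul => [z [m [sz /Theta0_mul[w [y [tw uy H1]]] H2]]].
have [mE _] := gmul_src H2; have [wE _] := gmul_src H1.
have [v H3] : exists v, gmul z w v by apply: gmul_ex; rewrite mE (gmul_rng H1).
have [_ vE] := gmul_src H3.
have [k' H4] : exists k', gmul v y k' by apply: gmul_ex; rewrite vE.
apply/Theta0_mul; exists v, y; split=> //; first by apply/Theta0_mul; exists z, w.
have [m' H5 H6] := gmulA H3 H4; rewrite (gmul_fun H5 H1) in H6.
by rewrite (gmul_fun H2 H6).
Qed.

(** The source of the product determines [w] inside [Theta t], and the range of [w] then determines
    [z] inside [Theta s]. *)
Lemma gmul_inv_uniq s t z w v z' w' : Theta s z -> Theta s z' ->
  Theta t w -> Theta t w' -> gmul z w v -> gmul z' w' v -> z = z' /\ w = w'.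
Proof.
move=> sz sz' tw tw' H H'; have [zE vE] := gmul_src H;
  have [zE' vE'] := gmul_src H'.
have ww : w = w' by apply: (Theta_src_inj (mem_set tw) (mem_set tw'));
  rewrite -vE -vE'.
by split=> //; apply: (Theta_src_inj (mem_set sz) (mem_set sz'));
  rewrite zE zE' ww.
Qed.

Definition sstar (s : SGE T) : SGE T := omap (@tstar T) s.

Lemma tstarK : involutive (@tstar T).
Proof. by move=> t; apply: val_inj; case: t => -[[a g] b] p /=;
  rewrite invgK. Qed.

Lemma tleft_tstar t : tleft (tstar t) = tright t.
Proof. by case: t => -[[a g] b]. Qed.

Lemma tright_tstar t : tright (tstar t) = tleft t.
Proof. by case: t => -[[a g] b]. Qed.

Lemma tgrp_tstar t : tgrp (tstar t) = (tgrp t)^-1.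
Proof. by case: t => -[[a g] b]. Qed.

Lemma pprefix_anti a b : is_path a -> pprefix a b -> pprefix b a -> a = b.
Proof.
case: a b => va p [vb q] _ /andP[/= /eqP -> /prefixP[p' qE]] /andP[_ /= qp].
congr pair; have := size_prefix qp;
  rewrite qE size_cat -{2}[size p]addn0 leq_add2l.
by rewrite leqn0 => /eqP/size0nil ->; rewrite cats0.
Qed.

Lemma sstar_mul (s t : SGE T) : sstar (smul s t) = smul (sstar t) (sstar s).
Proof.
case: s t => [s|] [t|] //.
have E : pre_mul (pre_star (tval t)) (pre_star (tval s)) =
    omap (@pre_star T) (pre_mul (tval s) (tval t)).
  have psh := psrc_tleft t; have pt := tleftP t.
  move: psh pt; rewrite (triple_eta s) (triple_eta t).
  set b := tright s; set c := tleft t; set h := tgrp t; set d := tright t.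
  rewrite /pre_star /pre_mul => cd pc.
  case: (boolP (pprefix b c)) => bc; case: (boolP (pprefix c b)) => cb //=.
  (* When just one prefix test succeeds, the star exchanges the two branches of [pre_mul]. When both
     succeed, both sides take the first branch, and they agree because the tails are empty. *)
  - have cE := pprefix_anti pc cb bc.
    rewrite -cE /ptail drop_size /pcat /pact /pphi /= !cats0 invgM.
    by case: (d) (tleft s) => ? ? [].
  - by rewrite invgM invgK.
  - by rewrite invgM invgK.
rewrite /=; case F : (triple_mul s t) => [u|] /=.
  have /smulE uE := F; apply/esym/smulE; rewrite /= E.
  by rewrite uE.
have sF : pre_mul (tval s) (tval t) = None.
  case sE : (pre_mul _ _) => [r|] //; have [u _] := pre_mul_Some sE.
  by rewrite /= F.
by apply/esym/smul_None; rewrite E sF.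
Qed.

Lemma act_tripleK s x (sx : cyl (tright s) x) : act_triple (tstar_cyl sx) = x.
Proof.
apply: ipath_inj => k.
rewrite -[LHS]/(icat (tleft (tstar s)).2 (iact (tgrp (tstar s)) (shift (size
  (tright (tstar s)).2) (act_triple sx))) k).
rewrite tleft_tstar tright_tstar tgrp_tstar shift_act_triple.
have -> : iact (tgrp s)^-1 (iact (tgrp s) (shift (size (tright s).2) x)) =
          shift (size (tright s).2) x.
  by rewrite -iactM mulVg iact1.
by rewrite -{1}(cyl_mkseq (trightP s) sx) icat_shift.
Qed.

Lemma ginvK : involutive (@ginv T).
Proof.
move=> z; rewrite -(germ_repr z) !ginv_germ.
(* The base point is generalised to [y] because the proof that it lies in the cylinder depends on
   it. *)
have H : forall y (p : cyl (tright (tstar (tstar (pg_triple (repr z))))) y)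
  (q : cyl (tright (pg_triple (repr z))) (pg_path (repr z))), y = pg_path (repr
    z) ->
  germ p = germ q.
  move=> y p q E; case: _ / (esym E) p => p; apply: germ_triple_eq.
  by rewrite tstarK.
by apply: H; exact: act_tripleK.
Qed.

Lemma Theta_star s z : Theta (tstar s) z <-> Theta s (ginv z).
Proof.
suff H t (y : Gtight T) : Theta t y -> Theta (tstar t) (ginv y).
  by split=> /H; rewrite ?tstarK ?ginvK.
by move=> [x [tx ->]]; rewrite ginv_germ; exact: Theta_germ.
Qed.

Lemma Theta0_star (s : SGE T) z : Theta0 (sstar s) z <-> Theta0 s (ginv z).
Proof. by case: s => [s|] //=; exact: Theta_star. Qed.

Lemma gsrc_ginv z : gsrc (ginv z) = grng z.
Proof. by rewrite -(germ_repr z) ginv_germ gsrc_germ grng_germ. Qed.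

Lemma Theta_rng_inj s : set_inj (Theta s) (@grng T).
Proof.
move=> z w /set_mem sz /set_mem sw E; apply: (can_inj ginvK).
apply: (Theta_src_inj (s := tstar s)); rewrite ?gsrc_ginv //;
  by apply/mem_set/Theta_star; rewrite ginvK.
Qed.

End GroupoidLaws.

(** * Compactness and the topology of the groupoid *)

Lemma compact_coverP (X : topologicalType) (A : set X) :
  compact A <-> cover_compact A.
Proof.
have [->|/set0P[p _]] := eqVneq A set0; last first.
  (* A point of a nonempty [A] serves as the base point under which [compact_cover] applies. *)
  pose Y : ptopologicalType := HB.pack X (isPointed.Build X p).
  by rewrite -[compact A]/(compact (A : set Y)) compact_cover.
split=> _; last exact: compact0.
by move=> I D f _ _; exists fset0.
Qed.

Section Topology.
Local Open Scope group_scope.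
Variable T : self_similar.
Notation G := (grp T).
Notation E1 := (edge (gph T)).
Implicit Types (x y : ipath T) (a b c d : prepath T) (s t u : triple T).
Implicit Types (z w v : Gtight T).

Lemma is_path_pcat_epath c (e : E1) : is_path c -> rng e = psrc c ->
  is_path (pcat c (epath e)).
Proof.
case: c => v p; rewrite /is_path composable_cat => /= -> ->.
by rewrite eqxx.
Qed.

Lemma psrc_pcat_epath c (e : E1) : psrc (pcat c (epath e)) = src e.
Proof. by rewrite /psrc /= map_cat last_cat. Qed.

(** A Koenig argument, used for the compactness of [Theta s] and for injectivity. If [P] fails at a
    path, it fails at some extension by an edge; choosing such edges forever gives an infinite path
    through [b] with [P] false at all its prefixes from [b] on. *)
Lemma iprefix_ext (P : prepath T -> Prop) :
  (forall c, is_path c ->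
    (forall e, rng e = psrc c -> P (pcat c (epath e))) -> P c) ->
  forall b, is_path b ->
  (forall x, cyl b x -> exists n, P (iprefix x (size b.2 + n))) -> P b.
Proof.
move=> Pstep b pb Pb; apply: contrapT => nPb.
pose bad := {c : prepath T | is_path c /\ ~ P c}.
have next (c : bad) : exists e, rng e = psrc (sval c) /\ ~ P (pcat (sval c)
  (epath e)).
  case: c => c [pc nPc] /=; apply: contrapT => H; apply: nPc.
  apply: Pstep => // e er; apply: contrapT => nPe; apply: H.
  by exists e.
have [ch chP] := choice next.
pose step (c : bad) : bad := exist _ (pcat (sval c) (epath (ch c)))
  (conj (is_path_pcat_epath (proj1 (svalP c)) (proj1 (chP c))) (proj2 (chP c))).
pose bs n := iter n step (exist _ b (conj pb nPb)).
have ydef n : src (ch (bs n)) = rng (ch (bs n.+1)).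
  by rewrite (proj1 (chP _)) /= psrc_pcat_epath.
pose y := IPath ydef.
have yb : irng y = psrc b by rewrite /irng /= (proj1 (chP _)).
have xdef : forall n, src (icat b.2 y n) = rng (icat b.2 y n.+1).
  by apply: (@composable_icat _ b.1) => //; case: (b) yb.
pose x := IPath xdef.
have bx : cyl b x by exists y.
have sx : shift (size b.2) x = y.
  by apply: ipath_inj => k /=; rewrite /icat nth_default ?leq_addr // addKn.
have [n] := Pb x bx; rewrite iprefixD ((cylP _ pb).1 bx) sx.
suff -> : pcat b (iprefix y n) = sval (bs n) by apply: (proj2 (svalP (bs n))).
elim: n => [|n IH]; first by rewrite /pcat /= cats0; case: (b).
rewrite /= -IH /pcat /= mkseqS -cats1; by rewrite catA.
Qed.

Lemma cyl_iprefix x n : cyl (iprefix x n) x.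
Proof. by apply/cylP; [exact: is_path_iprefix | rewrite size_mkseq]. Qed.

Lemma cyl_step c x : is_path c -> cyl c x ->
  exists e, rng e = psrc c /\ cyl (pcat c (epath e)) x.
Proof.
move=> pc cx; exists (x (size c.2)).
have er : rng (x (size c.2)) = psrc c.
  by rewrite -(cyl_shift pc cx) /irng /= addn0.
split=> //; apply/cyl_pcat; first exact: is_path_pcat_epath.
by split=> //=; rewrite /mkseq /= addn0.
Qed.

(** A restricted triple depends on [x] only through a prefix, so an equality of germs at [x] spreads
    to all paths that share a long prefix with [x]. *)
Lemma germ_eq_local s t x (sx : cyl (tright s) x) (tx : cyl (tright t) x) :
  germ sx = germ tx -> exists N, forall n z, (N <= n)%N ->
  Theta s z -> cyl (iprefix x n) (gsrc z) -> Theta t z.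
Proof.
move=> /germP/germ_eq_large [N [sN tN E]]; exists N => n z Nn [y [sy ->]].
rewrite gsrc_germ => /cylP; rewrite size_mkseq => /(_ (is_path_iprefix _ _)) yx.
have ty : cyl (tright t) y.
  apply/cylP; first exact: trightP.
  have tn := leq_trans tN Nn.
  have := (cylP _ (trightP t)).1 tx; move: yx.
  have [k ->] : exists k, n = (size (tright t).2 + k)%N by exists (n - size
    (tright t).2)%N; lia.
  rewrite !iprefixD /pcat => -[rE] /eqP; rewrite eqseq_cat ?size_mkseq //.
  by case/andP => /eqP mE _ tE; rewrite -[RHS]tE /iprefix rE mE.
exists y, ty; apply/germP/germ_eqP; split=> //; exists n.
have := tresW sx tx Nn E; by rewrite /tres yx.
Qed.

Lemma open_Theta s : open (Theta s).
Proof.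
by exists [set Some s] => //; exact: (bigcup_set1 (@Theta0 T)).
Qed.

Lemma open_base (B : set (Gtight T)) z : open B -> B z ->
  exists2 s, Theta s z & Theta s `<=` B.
Proof.
move=> [D _ <-] [[s|] Ds] //= sz; exists s => // w sw.
by exists (Some s).
Qed.

Lemma compact_Theta s : compact (Theta s).
Proof.
apply/compact_coverP => I D f fo cov.
(* [P c] says that the part of [Theta s] lying over the cylinder of [c] has a finite subcover. *)
pose P c := exists2 l : seq I, (forall i, i \in l -> D i) &
  forall z, Theta s z -> cyl c (gsrc z) -> exists2 i, i \in l & f i z.
suff [l lD lP] : P (tright s).
  exists [fset i | i in l]%fset; first by move=> i; rewrite !inE => /lD.
  move=> z [x [sx ->]]; have [|i il fi] := lP _ (Theta_germ sx).
    by rewrite gsrc_germ.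
  by exists i => //=; rewrite inE.
apply: iprefix_ext; last 2 first.
- exact: trightP.
(* One member of the cover contains the germ of [s] at [x], hence a basic set around it, hence all
   germs of [Theta s] over a long prefix of [x]. *)
- move=> x sx; have [i Di fi] := cov _ (Theta_germ sx).
  have [t [y [ty tE]] tB] := open_base (fo i Di) fi.
  have xy : x = y by rewrite -(gsrc_germ sx) tE gsrc_germ.
  case: _ / xy ty tE => ty tE; have [N H] := germ_eq_local tE.
  exists N, [:: i]; first by move=> j; rewrite inE => /eqP ->.
  move=> z sz /(H _ z (leq_addl _ _) sz) tz.
  by exists i; rewrite ?mem_head //; exact: tB.
- move=> c pc Pc.
  (* By row-finiteness the subcovers over the extensions by an edge can be concatenated. Edges that
     do not extend [c] are given the empty list. *)
  have /finite_seqP[le leE] := gph_row_finite (psrc c).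
  have /choice[L LP] : forall e : E1, exists l : seq I, (forall i, i \in l ->
    D i) /\
    (rng e = psrc c ->
     forall z, Theta s z -> cyl (pcat c (epath e)) (gsrc z) ->
       exists2 i, i \in l & f i z).
    move=> e; have [/Pc[l lD lP]|ne] := pselect (rng e = psrc c);
      first by exists l.
    by exists [::].
  exists (flatten (map L le)).
    by move=> i /flatten_mapP[e _]; apply: (LP e).1.
  move=> z sz cz; have [e [er ez]] := cyl_step pc cz.
  have [i ie fi] := (LP e).2 er _ sz ez; exists i => //.
  apply/flatten_mapP; exists e => //.
  by have : [set` le] e by rewrite -leE.
Qed.

Lemma Theta_bisection s : compact_open_bisection (Theta s).
Proof.
split; [exact: compact_Theta | exact: open_Theta | exact: Theta_src_inj |
  exact: Theta_rng_inj].
Qed.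

(** Inside [B] a germ is determined by its source, so two such sets intersect exactly as their
    cylinders do. Cylinders are nested or disjoint; [None] stands for the empty intersection. *)
Lemma Theta_nested (B : set (Gtight T)) s t : set_inj B (@gsrc T) ->
  Theta s `<=` B -> Theta t `<=` B ->
  exists r : SGE T, Theta s `&` Theta t = Theta0 r.
Proof.
move=> Binj.
wlog st : s t / pprefix (tright s) (tright t) => [H sB tB|sB tB].
  have [st|nst] := boolP (pprefix (tright s) (tright t)); first exact: H.
  have [ts|nts] := boolP (pprefix (tright t) (tright s)).
    by rewrite setIC; exact: H.
  exists None; apply/seteqP; split=> // z [[x [sx ->]] [y [ty /(congr1 (@gsrc
    T))]]].
  rewrite !gsrc_germ => xy; case: _ / xy ty => tx.
  by have := pprefix_common (trightP s) (trightP t) sx tx;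
    rewrite (negbTE nst) (negbTE nts).
exists (Some t); apply/seteqP; split=> [z []|z tz] //=; split=> //.
have [x [tx zE]] := tz; have [e tE] := pprefixP _ _ st.
have sx : cyl (tright s) x.
  have pt := trightP t; move: (tx); rewrite tE in pt *.
  by case/(cyl_pcat _ pt).
suff -> : z = germ sx by exact: Theta_germ.
apply: Binj; rewrite ?inE; [exact: tB | exact/sB/Theta_germ | ].
by rewrite zE !gsrc_germ.
Qed.

Lemma compact_open_Theta (B : set (Gtight T)) : compact B -> open B ->
  exists2 l : seq (triple T), (forall s, s \in l -> Theta s `<=` B) &
    B = \bigcup_(s in [set` l]) Theta s.
Proof.
move=> /compact_coverP cB oB.
have [|z Bz|D DB BD] := cB _ [set s | Theta s `<=` B] (@Theta T).
- by move=> s _; exact: open_Theta.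
- by have [s sz sB] := open_base oB Bz; exists s.
exists (D : seq _); first by move=> s /DB; rewrite inE.
apply/seteqP; split=> [z /BD[s sD sz]|z [s /= /DB]]; first by exists s.
by rewrite inE; exact.
Qed.

End Topology.

(** * The span of the indicators of the sets [Theta s] as a star-algebra *)

Section SteinbergAlgebra.
Local Open Scope ring_scope.
Variables (R : star_ring) (T : self_similar).
Implicit Types (s t u : SGE T) (z w v : Gtight T) (m n k : seq (R * SGE T)).

(** The zero of the semigroup is allowed in the lists, so that they are closed under products; [R^o]
    makes these functions a module over [R]. *)
Definition lincomb m : Gtight T -> R^o :=
  fun z => \sum_(p <- m) p.1 * \1_(Theta0 p.2) z.

Lemma lincomb_cat m n : lincomb (m ++ n) = lincomb m + lincomb n.
Proof. by apply: funext => z; rewrite /lincomb big_cat. Qed.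

Lemma lincomb_scale r m :
  lincomb [seq (r * p.1, p.2) | p <- m] = r *: lincomb m.
Proof.
apply: funext => z; rewrite /lincomb big_map [RHS]big_distrr /=.
by apply: eq_bigr => p _; rewrite mulrA.
Qed.

Lemma lincomb1 s : lincomb [:: (1, s)] = \1_(Theta0 s).
Proof. by apply: funext => z; rewrite /lincomb big_seq1 mul1r. Qed.

(** By [gmul_inv_uniq] each pair of terms contributes at most one factorisation of [v], so a finite
    list carries the whole convolution sum. *)
Lemma finite_factorisations m n v : exists r : seq (Gtight T * Gtight T),
  [/\ uniq r, forall P, P \in r -> gmul P.1 P.2 v
    & forall p q P, p \in m -> q \in n -> gmul P.1 P.2 v ->
        Theta0 p.2 P.1 -> Theta0 q.2 P.2 -> P \in r].
Proof.
have /choice[pick pickP] : forall pq : (R * SGE T) * (R * SGE T),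
    exists P0 : Gtight T * Gtight T, forall P, gmul P.1 P.2 v ->
    Theta0 pq.1.2 P.1 -> Theta0 pq.2.2 P.2 -> P = P0.
  (* The pair [(v, v)] is a default for terms without a factorisation; the filter below keeps only
     genuine factorisations of [v]. *)
  move=> [[a [s|]] [b [t|]]] /=; try by exists (v, v).
  have [[P [Pv sP tP]]|nP] := pselect (exists P, [/\ gmul P.1 P.2 v, Theta s P.1
    & Theta t P.2]); last by exists (v, v) => P Pv sP tP; case: nP; exists P.
  exists P => Q Qv sQ tQ.
  have [E1 E2] := gmul_inv_uniq sP sQ tP tQ Pv Qv.
  by case: P Q E1 E2 {Pv sP tP Qv sQ tQ} => ? ? [? ?] /= -> ->.
exists (undup [seq P <- [seq pick (p, q) | p <- m, q <- n] | `[< gmul P.1 P.2 v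
  >]]).
split; first exact: undup_uniq.
  by move=> P; rewrite mem_undup mem_filter => /andP[/asboolP].
move=> p q P pm qn Pv pP qP; rewrite mem_undup mem_filter; apply/andP; split.
  exact/asboolP.
by rewrite (pickP (p, q) P) //; exact: allpairs_f.
Qed.

(** By bilinearity it is enough to convolve two indicators, and there the sum has exactly one
    nonzero term or none, according to [Theta0_mul] and [gmul_inv_uniq]. *)
Lemma conv_lincomb m n :
  conv (lincomb m) (lincomb n) =
  lincomb [seq (p.1 * q.1, smul p.2 q.2) | p <- m, q <- n].
Proof.
apply: funext => v; have [r [r_uniq rv rP]] := finite_factorisations m n v.
rewrite /conv (fsbigE r) //; last first.
  move=> P Pv nPr; rewrite /lincomb big_distrl big1_seq //= => p pm.
  rewrite big_distrr big1_seq //= => q qn.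
  rewrite !indicE; case: (boolP (P.1 \in _)) => [|_]; last by rewrite mulr0 mul0r.
  case: (boolP (P.2 \in _)) => [|_]; last by rewrite !mulr0.
  by rewrite !inE => qP pP; case/negP: nPr; exact: rP pP qP.
rewrite big_seq_cond (eq_bigl (fun P => P \in r)) -?big_seq; last first.
  by move=> P; case: (boolP (P \in r)) => //= /rv Pv; exact: mem_set.
rewrite /lincomb big_allpairs_dep.
under eq_bigr do rewrite big_distrl.
rewrite exchange_big; apply: eq_big_seq => p pm /=.
under eq_bigr do rewrite big_distrr.
rewrite exchange_big; apply: eq_big_seq => q qn /=.
under eq_bigr do rewrite mulrACA.
rewrite -big_distrr; congr (_ * _) => /=.
rewrite indicE; case: (boolP (v \in _)) => [|nv].
  rewrite inE => /Theta0_mul[z [w [pz qw zwv]]].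
  rewrite (bigD1_seq (z, w)) //=; last exact: (rP p q).
  rewrite !indicE (mem_set pz) (mem_set qw) mulr1 big1_seq ?addr0 // =>
    P /andP[nP Pr].
  rewrite !indicE.
  case: (boolP (P.1 \in _)) => [|_]; last by rewrite mul0r.
  case: (boolP (P.2 \in _)) => [|_]; last by rewrite mulr0.
  rewrite !inE => qP pP; case/negP: nP; have Pv := rv _ Pr.
  case: p q {pm qn} pz qw qP pP => [a [s|]] [b [t|]] //= pz qw qP pP.
  have [E1 E2] := gmul_inv_uniq pz pP qw qP zwv Pv.
  by apply/eqP; case: P E1 E2 {Pr qP pP Pv} => ? ? /= -> ->.
rewrite big1_seq // => P /andP[_ Pr]; rewrite !indicE.
case: (boolP (P.1 \in _)) => [|_]; last by rewrite mul0r.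
case: (boolP (P.2 \in _)) => [|_]; last by rewrite mulr0.
rewrite !inE => qP pP; case/negP: nv; rewrite inE; apply/Theta0_mul.
by exists P.1, P.2; split=> //; exact: rv.
Qed.

Lemma convE m n v : conv (lincomb m) (lincomb n) v =
  \sum_(p <- m) \sum_(q <- n) p.1 * q.1 * \1_(Theta0 (smul p.2 q.2)) v.
Proof. by rewrite conv_lincomb /lincomb big_allpairs_dep. Qed.

Lemma fstar_lincomb m :
  fstar (lincomb m) = lincomb [seq (conjr R p.1, sstar p.2) | p <- m].
Proof.
apply: funext => z; rewrite /fstar /lincomb rmorph_sum big_map.
apply: eq_bigr => p _; rewrite rmorphM !indicE rmorph_nat; congr (_ * _%:R).
congr (nat_of_bool _).
by apply/idP/idP; rewrite !inE /= => /Theta0_star.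
Qed.

(** This span serves as the carrier in place of [steinberg], since products are explicit on it. It
    is contained in [steinberg] by [steinberg_val_hom], and [lincomb_bisection] yields the
    converse. *)
Definition theta_span : {pred Gtight T -> R^o} :=
  fun f => `[< exists m, f = lincomb m >].

Lemma theta_spanP f : reflect (exists m, f = lincomb m) (f \in theta_span).
Proof. exact: asboolP. Qed.

Lemma lincomb_span m : lincomb m \in theta_span.
Proof. by apply/theta_spanP; exists m. Qed.

Lemma theta_span_submod : submod_closed theta_span.
Proof.
split=> [|r f g /theta_spanP[m ->] /theta_spanP[n ->]].
  by apply/theta_spanP; exists [::]; apply: funext => z; rewrite /lincomb big_nil.
by rewrite -lincomb_scale -lincomb_cat lincomb_span.
Qed.

HB.instance Definition _ :=
  GRing.isSubmodClosed.Build R (Gtight T -> R^o) theta_span theta_span_submod.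

Record steinberg_type := SteinbergType {
  steinberg_val : Gtight T -> R^o;
  steinberg_valP : steinberg_val \in theta_span }.

HB.instance Definition _ := [isSub for steinberg_val].
HB.instance Definition _ := gen_eqMixin steinberg_type.
HB.instance Definition _ := gen_choiceMixin steinberg_type.
HB.instance Definition _ := [SubChoice_isSubLmodule of steinberg_type by <:].

End SteinbergAlgebra.

Section SteinbergStarAlgebra.
Local Open Scope ring_scope.
Variables (R : star_ring) (T : self_similar).
Local Notation S := (steinberg_type R T).
Implicit Types (a b c : S).

Lemma conv_span a b : conv (val a) (val b) \in @theta_span R T.
Proof.
have /theta_spanP[m ->] := valP a; have /theta_spanP[n ->] := valP b.
by rewrite conv_lincomb lincomb_span.
Qed.

Lemma fstar_span a : fstar (val a) \in @theta_span R T.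
Proof. by have /theta_spanP[m ->] := valP a;
  rewrite fstar_lincomb lincomb_span. Qed.

Definition steinberg_mul a b : S := SteinbergType (conv_span a b).
Definition steinberg_star a : S := SteinbergType (fstar_span a).

Lemma steinberg_mulA : associative steinberg_mul.
Proof.
move=> a b c; apply: val_inj => /=.
have /theta_spanP[m ->] := valP a; have /theta_spanP[n ->] := valP b.
have /theta_spanP[k ->] := valP c.
apply: funext => v; rewrite (conv_lincomb n k) (conv_lincomb m n) !convE.
rewrite big_allpairs_dep; apply: eq_bigr => p _; rewrite big_allpairs_dep.
apply: eq_bigr => q _; apply: eq_bigr => r _ /=.
by rewrite mulrA Theta0_mulA.
Qed.

Lemma steinberg_mulDl : left_distributive steinberg_mul +%R.
Proof.
move=> a b c; apply: val_inj.
rewrite -[LHS]/(conv (val a + val b) (val c)).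
rewrite -[RHS]/(conv (val a) (val c) + conv (val b) (val c)).
have /theta_spanP[m ->] := valP a; have /theta_spanP[n ->] := valP b.
have /theta_spanP[k ->] := valP c.
apply: funext => v; rewrite -lincomb_cat [RHS]/(_ v + _ v) !convE.
by rewrite big_cat.
Qed.

Lemma steinberg_mulDr : right_distributive steinberg_mul +%R.
Proof.
move=> a b c; apply: val_inj.
rewrite -[LHS]/(conv (val a) (val b + val c)).
rewrite -[RHS]/(conv (val a) (val b) + conv (val a) (val c)).
have /theta_spanP[m ->] := valP a; have /theta_spanP[n ->] := valP b.
have /theta_spanP[k ->] := valP c.
apply: funext => v; rewrite -lincomb_cat [RHS]/(_ v + _ v) !convE.
by under eq_bigr do rewrite big_cat; rewrite big_split.
Qed.

Lemma scale_steinberg_mull r a b :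
  r *: steinberg_mul a b = steinberg_mul (r *: a) b.
Proof.
apply: val_inj.
rewrite -[LHS]/(r *: (conv (val a) (val b) : Gtight T ->
  R^o)) -[RHS]/(conv (r *: val a) (val b)).
have /theta_spanP[m ->] := valP a; have /theta_spanP[n ->] := valP b.
apply: funext => v; rewrite -lincomb_scale [LHS]/(r * _ v) !convE.
rewrite [LHS]big_distrr big_map; apply: eq_bigr => p _.
by rewrite big_distrr; apply: eq_bigr => q _ /=; rewrite !mulrA.
Qed.

Lemma scale_steinberg_mulr r a b :
  r *: steinberg_mul a b = steinberg_mul a (r *: b).
Proof.
apply: val_inj.
rewrite -[LHS]/(r *: (conv (val a) (val b) : Gtight T ->
  R^o)) -[RHS]/(conv (val a) (r *: val b)).
have /theta_spanP[m ->] := valP a; have /theta_spanP[n ->] := valP b.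
apply: funext => v; rewrite -lincomb_scale [LHS]/(r * _ v) !convE.
rewrite [LHS]big_distrr; apply: eq_bigr => p _.
rewrite [LHS]big_distrr big_map; apply: eq_bigr => q _ /=.
by rewrite !mulrA (mulrC r).
Qed.

Lemma steinberg_starK : involutive steinberg_star.
Proof.
move=> a; apply: val_inj; apply: funext => z /=.
by rewrite /fstar ginvK conjrK.
Qed.

Lemma steinberg_starM a b : steinberg_star (steinberg_mul a b) = steinberg_mul
  (steinberg_star b) (steinberg_star a).
Proof.
apply: val_inj => /=.
have /theta_spanP[m ->] := valP a; have /theta_spanP[n ->] := valP b.
rewrite conv_lincomb !fstar_lincomb; apply: funext => v; rewrite convE.
rewrite /lincomb big_map big_allpairs_dep big_map exchange_big.
apply: eq_bigr => q _; rewrite big_map; apply: eq_bigr => p _ /=.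
by rewrite sstar_mul rmorphM (mulrC (conjr R p.1)).
Qed.

Lemma steinberg_starZD r a b : steinberg_star (r *: a + b) = conjr R r *:
  steinberg_star a + steinberg_star b.
Proof.
apply: val_inj; apply: funext => z /=.
rewrite -[LHS]/(conjr R (r * val a (ginv z) + val b (ginv z))) rmorphD rmorphM.
by [].
Qed.

Definition steinberg_alg : star_alg R :=
  StarAlg steinberg_mulA steinberg_mulDl steinberg_mulDr
  scale_steinberg_mull scale_steinberg_mulr steinberg_starK steinberg_starM
    steinberg_starZD.

Definition theta_ind (s : SGE T) : steinberg_alg :=
  SteinbergType (lincomb_span [:: (1, s)]).

Lemma val_ind s : val (theta_ind s) = \1_(Theta0 s).
Proof. exact: lincomb1. Qed.

Lemma ind_mul s t : theta_ind s ** theta_ind t = theta_ind (smul s t).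
Proof.
apply: val_inj; rewrite [LHS]conv_lincomb /= mulr1.
by rewrite !lincomb1.
Qed.

Lemma ind_star s : (theta_ind s)^# = theta_ind (sstar s).
Proof. by apply: val_inj; rewrite [LHS]fstar_lincomb /= rmorph1. Qed.

Lemma ind0 : theta_ind None = 0.
Proof. by apply: val_inj; rewrite val_ind /= indic0. Qed.

End SteinbergStarAlgebra.

(** * The (G,E)-family of indicators *)

Section SteinbergFamily.
Local Open Scope ring_scope.
Variables (R : star_ring) (T : self_similar).
Local Notation G := (grp T).
Local Notation E0 := (vert (gph T)).
Local Notation E1 := (edge (gph T)).
Local Notation theta_ind := (@theta_ind R T).
Implicit Types (x : ipath T) (b c : prepath T) (z : Gtight T).

Lemma av_eqV (f : G) (v w : E0) : (av f^-1 v == w) = (v == av f w).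
Proof. exact: can2_eq (avVK f) (avK f) _ _. Qed.

Lemma ind_mulE (s t : triple T) :
  theta_ind (Some s) ** theta_ind (Some t) = theta_ind (obind insub (pre_mul
    (tval s) (tval t))).
Proof. exact: ind_mul. Qed.

Lemma ind_starE (s : triple T) :
  (theta_ind (Some s))^# = theta_ind (Some (tstar s)).
Proof. exact: ind_star. Qed.

Lemma insub_triple (t : triple T) r : r = tval t -> insub r = Some t.
Proof. by move=> ->; exact: valK. Qed.

Lemma tres_tidem b (pb : is_path b) x n : cyl b x -> (size b.2 <= n)%N ->
  tres (tidem pb) x n = Some (iprefix x n, 1%g, iprefix x n).
Proof.
move=> bx bn; rewrite tresE // /pphi phis1 /pact /= actv1 act_seq1.
congr (Some (_, _, _)).
by rewrite -[in RHS](subnKC bn) iprefixD ((cylP _ pb).1 bx).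
Qed.

(** All idempotents whose cylinder contains a path have the same germ there, so membership is
    decided by the source alone. *)
Lemma Theta_tidem b c (pb : is_path b) (pc : is_path c) z :
  Theta (tidem pb) z -> cyl c (gsrc z) -> Theta (tidem pc) z.
Proof.
move=> [x [bx ->]]; rewrite gsrc_germ => cx; exists x, cx.
apply/germP/germ_eqP; split=> //=; exists (size b.2 + size c.2)%N.
by rewrite !tres_tidem // ?leq_addl ?leq_addr.
Qed.

Lemma is_path_epath (e : E1) : is_path (epath e).
Proof. by rewrite /is_path /= eqxx. Qed.

Lemma is_path_vpath (v : E0) : is_path (vpath v).
Proof. by []. Qed.

Definition indP (v : E0) (f : G) := theta_ind (Some (vtriple v f)).
Definition indS (e : E1) (g : G) := theta_ind (Some (etriple e g)).

Lemma indP1 v : indP v 1 = theta_ind (Some (tidem (is_path_vpath v))).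
Proof. by congr (theta_ind (Some _)); apply: val_inj; rewrite /= invg1 actv1. Qed.

Lemma indS1 e : indS e 1 ** (indS e 1)^# = theta_ind (Some (tidem
  (is_path_epath e))).
Proof.
rewrite ind_starE ind_mulE /= invg1 actv1 pprefix_refl /=.
by rewrite /= (insub_triple (t :=
  tidem (is_path_epath e))) //= /pphi /ptail /= mulg1.
Qed.

(** An infinite path with range [v] lies in the cylinder of exactly one edge, its first edge
    [x 0]. *)
Lemma ind_sum v :
  indP v 1 = \sum_(e \in [set e | rng e = v]) indS e 1 ** (indS e 1)^#.
Proof.
rewrite indP1 fsbig_finite; last exact: gph_row_finite.
under eq_bigr do rewrite indS1.
apply: val_inj; apply: funext => z.
rewrite (big_morph (fun a : steinberg_alg R T =>
  val a z) (id1 := 0) (op1 := +%R)) //.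
under eq_bigr do rewrite val_ind.
have er e : e \in fset_set [set e | rng e = v] -> rng e = v.
  by rewrite in_fset_set ?inE //; exact: gph_row_finite.
rewrite val_ind /= indicE; case: (boolP (z \in _)) => [|nz].
  rewrite inE => vz; have [x [vx zE]] := vz.
  have xv : irng x = v by have /(cylP _ (is_path_vpath v)) [] := vx.
  have ex (e : E1) : cyl (epath e) x -> e = x 0.
    by move=> /(cylP _ (is_path_epath e)) [].
  rewrite (bigD1_seq (x 0)) ?fset_uniq //=; last first.
    by rewrite in_fset_set ?inE //; exact: gph_row_finite.
  rewrite indicE mem_set ?big1_seq ?addr0 //.
    move=> e /andP[ne _]; rewrite indicE memNset // => -[y [ey]].
    rewrite zE => /(congr1 (@gsrc T)); rewrite !gsrc_germ => xy.
    by case/negP: ne; apply/eqP/ex; rewrite xy.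
  apply: Theta_tidem vz _; apply/cylP; first exact: is_path_epath.
  by rewrite zE gsrc_germ.
rewrite big1_seq // => e /andP[_ /er ev]; rewrite indicE memNset // => ez.
have [x [ex zE]] := ez; case/negP: nz; rewrite inE; apply: Theta_tidem ez _.
rewrite zE gsrc_germ; apply/cylP => //.
by rewrite /iprefix -ev; have /(cylP _ (is_path_epath e)) [-> _] := ex.
Qed.

Lemma ind_family : GE_family indP indS.
Proof.
split.
- split.
  + move=> v; split.
      by rewrite ind_starE; congr (theta_ind (Some _)); apply: val_inj;
        rewrite /= invg1 actv1.
    by rewrite indP1 ind_mulE /= pprefix_refl /= (insub_triple (t :=
      tidem (is_path_vpath v))) //= mulg1.
  + move=> v w vw; rewrite !indP1 ind_mulE /pre_mul /pprefix /= !andbT.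
    by rewrite (negbTE vw) eq_sym (negbTE vw) ind0.
  + move=> e; rewrite /is_partial_isometry indS1 ind_mulE /= pprefix_refl /=.
    rewrite /= (insub_triple (t := etriple e 1)) //= /pphi /= mulg1.
    by rewrite /pcat /pact /ptail.
  + move=> e f; rewrite ind_starE ind_mulE /= /pprefix /= !andbT.
    have [<-|_] := eqVneq e f; last by rewrite !andbF ind0.
    rewrite eqxx /= indP1 (insub_triple (t := tidem (is_path_vpath (src e)))) //.
    by rewrite /= /pcat /pact /pphi /ptail /= !invg1 !actv1 mulg1.
  + exact: ind_sum.
- move=> v f; rewrite ind_starE; congr (theta_ind (Some _)); apply: val_inj => /=.
  by rewrite invgK avVK.
- move=> v w f h; rewrite ind_mulE /= /pprefix /= !andbT av_eqV.
  have [vE|nv] := eqVneq v (av f w); last first.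
    by rewrite eq_sym av_eqV (negbTE nv) ind0.
  rewrite /= (insub_triple (t := vtriple v (f * h))) //= /pcat /pphi /=.
  by rewrite invgM actvM vE avK.
- move=> v f e g; rewrite ind_mulE /= /pprefix /= !andbT andbF av_eqV -rng_act.
  case: eqVneq => [vE|_]; last exact: ind0.
  rewrite /= (insub_triple (t := etriple (ae f e) (phi f e * g))) //=.
  rewrite /pcat /pphi /ptail /epath /= -vE; congr (_, _, vpath _).
  by rewrite src_act invgM actvM -(phi_act f e) avK.
- move=> v f e g; rewrite ind_mulE /= /pprefix /= !andbT av_eqV (eq_sym (src e)).
  have [vE|nv] := eqVneq (av g v) (src e); last first.
    by rewrite eq_sym av_eqV eq_sym (negbTE nv) ind0.
  rewrite /= (insub_triple (t := etriple e (g * f))) //= /pcat /pphi /=.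
  by rewrite invgM actvM -vE avK.
Qed.

Lemma steinberg_val_hom :
  steinberg_hom (fun a : steinberg_alg R T => val a : Gtight T -> R).
Proof.
split=> // a; have /theta_spanP[m ->] := valP a.
exists (size m), (fun i => (tnth (in_tuple m) i).1),
  (fun i => Theta0 (tnth (in_tuple m) i).2); split=> [i|z].
  case: (_.2) => [s|]; first exact: Theta_bisection.
  split; [exact: compact0|exact: open0| |]; by move=> ? ?; rewrite inE.
by rewrite /lincomb big_tnth.
Qed.

End SteinbergFamily.

(** * Path elements in an arbitrary (G,E)-family *)

Section StarAlgebra.
Local Open Scope ring_scope.
Variables (R : star_ring) (A : star_alg R).
Implicit Types a b : A.

Lemma amulr0 a : a ** 0 = 0.
Proof. by apply: (addrI (a ** 0)); rewrite -amulDr !addr0. Qed.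

Lemma amul0r a : 0 ** a = 0.
Proof. by apply: (addrI (0 ** a)); rewrite -amulDl !addr0. Qed.

Lemma astar0 : (0 : A)^# = 0.
Proof.
have := astarZD 1 (0 : A) 0; rewrite scaler0 addr0 rmorph1 scale1r => E.
by apply: (addrI (0 : A)^#); rewrite -E addr0.
Qed.

Lemma amul_suml (I : Type) (l : seq I) (f : I -> A) a :
  (\sum_(i <- l) f i) ** a = \sum_(i <- l) f i ** a.
Proof. by apply: (big_morph (amul^~ a)) => [b c|];
  [exact: amulDl | exact: amul0r]. Qed.

Lemma amul_sumr (I : Type) (l : seq I) (f : I -> A) a :
  a ** (\sum_(i <- l) f i) = \sum_(i <- l) a ** f i.
Proof. by apply: (big_morph (amul a)) => [b c|];
  [exact: amulDr | exact: amulr0]. Qed.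

End StarAlgebra.

Section PathElements.
Local Open Scope ring_scope.
Variables (R : star_ring) (T : self_similar) (A : star_alg R).
Local Notation G := (grp T).
Local Notation E0 := (vert (gph T)).
Local Notation E1 := (edge (gph T)).
Variables (P : E0 -> G -> A) (S : E1 -> G -> A).
Implicit Types (a b c : prepath T) (s t : triple T).

Fixpoint seq_elt (v : E0) (p : seq E1) (g : G) : A :=
  if p is e :: p' then S e 1%g ** seq_elt (src e) p' g else P v g.

(* [s_a p_(s(a), g)] and [s_a p_(s(a), g) s_b^*]. *)
Definition path_elt a g : A := seq_elt a.1 a.2 g.

Definition triple_elt (r : pretriple T) : A :=
  let: (a, g, b) := r in path_elt a g ** (path_elt b 1%g)^#.

Hypothesis F : GE_family P S.

Lemma path_eltP a g w h :
  path_elt a g ** P w h = if psrc a == av g w then path_elt a (g * h)%g else 0.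
Proof.
case: a => v p; rewrite /path_elt /psrc /=.
elim: p v => [|e p IH] v /=; first exact: (GEfam_PP F).
by rewrite -amulA IH; case: ifP => // _; exact: amulr0.
Qed.

Lemma path_elt_src a g : path_elt a 1%g ** P (psrc a) g = path_elt a g.
Proof. by rewrite path_eltP actv1 eqxx mul1g. Qed.

Lemma edge_eltP e g : S e 1%g ** P (src e) g = S e g.
Proof. by rewrite (GEfam_SP F) actv1 eqxx mul1g. Qed.

(** Relation (d) is applied edge by edge: each edge passed is moved by the current group element,
    which is then replaced by its cocycle. *)
Lemma Ppath_elt v k a h : is_path a ->
  P v k ** path_elt a h =
  if v == av k a.1 then path_elt (pact k a) (pphi k a * h)%g else 0.
Proof.
case: a => w p; rewrite /path_elt /is_path /pphi /=.
elim: p v w k => [|e p IH] v w k /=.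
  by move=> _; rewrite (GEfam_PP F); case: eqP => // ->.
case/andP => /eqP <- pp; rewrite amulA (GEfam_PS F) rng_act mulg1.
case: ifP => _; last exact: amul0r.
rewrite -edge_eltP -amulA IH // src_act phi_act eqxx.
by rewrite -(phi_act k e).
Qed.

Lemma Ppath_elt1 a h : is_path a -> P a.1 1%g ** path_elt a h = path_elt a h.
Proof.
move=> pa; rewrite Ppath_elt // actv1 eqxx /pact /pphi act_seq1 phis1 mul1g actv1.
by case: (a).
Qed.

Lemma path_elt_cat a b g : is_path (pcat a b) ->
  path_elt (pcat a b) g = path_elt a 1%g ** path_elt (psrc a, b.2) g.
Proof.
case: a b => v p [w q]; rewrite /path_elt /is_path /psrc /=.
elim: p v => [|e p IH] v /=; first by move=> vq; rewrite (@Ppath_elt1 (v, q)).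
by case/andP => _ pq; rewrite -amulA IH.
Qed.

Lemma path_elt_mul a g b h : psrc a = av g (prng b) -> is_path a -> is_path b ->
  path_elt a g ** path_elt b h = path_elt (pcat a (pact g b)) (pphi g b * h)%g.
Proof.
move=> ab pa pb; rewrite -(path_elt_src a g) -amulA Ppath_elt // ab eqxx.
rewrite path_elt_cat ?ab //.
rewrite /is_path /= composable_cat; apply/andP; split; first exact: pa.
have -> : last a.1 [seq src e | e <- a.2] = av g (prng b) by rewrite -ab.
by rewrite composable_act.
Qed.

Lemma path_elt_isom a : is_path a ->
  (path_elt a 1%g)^# ** path_elt a 1%g = P (psrc a) 1%g.
Proof.
case: a => v p; rewrite /path_elt /is_path /psrc /=.
elim: p v => [|e p IH] v /=.
  by move=> _; have [<- <-] := Efam_proj (GEfam_E F) v.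
case/andP => _ pp; rewrite astarM -amulA (amulA _ (S e 1%g)).
rewrite (Efam_SS (GEfam_E F)) eqxx.
by rewrite (@Ppath_elt1 (src e, p)) // IH.
Qed.

Lemma path_elt_star_cat b c h : is_path (pcat b c) ->
  (path_elt b 1%g)^# ** path_elt (pcat b c) h = path_elt (psrc b, c.2) h.
Proof.
move=> pbc; move: (pbc); rewrite /is_path composable_cat => /andP[pb pc].
by rewrite path_elt_cat // amulA path_elt_isom // (@Ppath_elt1 (psrc b, c.2)).
Qed.

(** Common initial edges cancel, and the first pair of distinct edges gives zero; different ranges
    give zero by the orthogonality of the vertex projections. *)
Lemma path_elt_orth b c h : is_path b -> is_path c ->
  ~~ pprefix b c -> ~~ pprefix c b -> (path_elt b 1%g)^# ** path_elt c h = 0.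
Proof.
case: b c => v p [w q] pb pc; rewrite /pprefix /= (eq_sym w).
have [vw|nvw] := eqVneq v w; last first.
  move=> _ _; rewrite -(Ppath_elt1 _ pb) -(Ppath_elt1 _ pc) astarM -amulA.
  have [<- _] := Efam_proj (GEfam_E F) v.
  by rewrite (amulA (P v 1%g)) /= (Efam_orth (GEfam_E F) nvw) amul0r amulr0.
rewrite -{w}vw /= in pc *.
elim: p q v pb pc => [|e p IH] [|f q] v; rewrite ?prefix0s //=.
case/andP => /= _ pb /andP[/= _ pc]; rewrite (eq_sym f).
rewrite /path_elt /= astarM -amulA (amulA _ (S f 1%g)) (Efam_SS (GEfam_E F)).
case: eqVneq pc => [<-|_] pc /=; last by rewrite amul0r amulr0.
by move=> n1 n2; rewrite (@Ppath_elt1 (src e, q)) //; exact: IH.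
Qed.

Lemma triple_elt_star s : (triple_elt (tval s))^# = triple_elt (pre_star (tval
  s)).
Proof.
rewrite (triple_eta s) /= astarM astarK.
rewrite -(path_elt_src (tleft s) (tgrp s)) astarM (GEfam_star F) amulA path_eltP.
by rewrite actv1 psrc_tleft avK eqxx mul1g.
Qed.

Lemma path_elt_mulV a g b k : psrc a = av (g * k^-1)%g (psrc b) ->
  path_elt a g ** (path_elt b k)^# = path_elt a (g * k^-1)%g ** (path_elt b
    1%g)^#.
Proof.
move=> ab; rewrite -(path_elt_src b k) astarM (GEfam_star F) amulA path_eltP.
by rewrite -actvM ab eqxx.
Qed.

Lemma path_elt_star_mul b c h k : is_path (pcat b c) ->
  (path_elt b h)^# ** path_elt (pcat b c) k =
  path_elt (pact h^-1%g (psrc b, c.2)) (pphi h^-1%g c * k)%g.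
Proof.
move=> pbc; rewrite -(path_elt_src b h) astarM -amulA path_elt_star_cat //.
rewrite (GEfam_star F) Ppath_elt ?eqxx //.
by move: pbc; rewrite /is_path composable_cat => /andP[].
Qed.

(** The star of the path element of [tright s] meets the path element of [tleft t]: it cancels the
    shorter path, or it gives zero if neither is a prefix of the other. *)
Lemma triple_elt_mul s t : triple_elt (tval s) ** triple_elt (tval t) =
  if pre_mul (tval s) (tval t) is Some r then triple_elt r else 0.
Proof.
have ps := tleftP s; have pt := trightP t.
have [[e [te ->]]|[[e [se ->]]|[n1 n2 ->]]] := smul_cases s t;
  rewrite {1}(triple_eta s) {1}(triple_eta t) /=;
  rewrite -amulA (amulA _ _ (_^#)).
- have p := tleftP t; rewrite te in p *; rewrite path_elt_star_cat //.
  rewrite amulA path_elt_mul ?psrc_tleft //.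
  by move: p; rewrite /is_path composable_cat => /andP[].
- have p := trightP s; rewrite se in p *.
  have pe : composable (psrc (tleft t)) e.2.
    by move: p; rewrite /is_path composable_cat => /andP[].
  have eE : psrc (psrc (tleft t), e.2) = psrc (tright s).
    by rewrite se /pcat psrc_cat; case: (tleft t).
  (* The longer path now stands under the star, so the middle product is computed through its
     adjoint. *)
  rewrite -[X in _ ** (X ** _)]astarK astarM astarK path_elt_star_mul //.
  rewrite -astarM path_elt_mul ?actv1 ?is_path_act //;
    last by rewrite /= psrc_tleft avK.
  rewrite /pphi phis1 mul1g mulg1 path_elt_mulV.
    by rewrite /pcat /pact /= act_seq1.
  have -> : pcat (tright t) (pact 1 (pact (tgrp t)^-1 (psrc (tleft t), e.2))) =
      ((tright t).1, (tright t).2 ++ act_seq (tgrp t)^-1 e.2).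
    by rewrite /pcat /= act_seq1.
  have dE : psrc ((tright t).1, (tright t).2) = av (tgrp t)^-1 (psrc (tleft t)).
    by rewrite psrc_tleft avK; case: (tright t).
  rewrite psrc_cat dE -[(_, act_seq _ _)]/(pact _ (psrc (tleft t), e.2))
    psrc_act eE.
  by rewrite actvM phisV_act invgK avVK psrc_tleft.
- by rewrite path_elt_orth ?amul0r ?amulr0 //; [exact: trightP | exact: tleftP].
Qed.

End PathElements.

(** * Elements attached to triples in the universal algebra *)

Section UniversalElements.
Local Open Scope ring_scope.
Variables (R : star_ring) (T : self_similar).
Local Notation G := (grp T).
Local Notation E0 := (vert (gph T)).
Local Notation E1 := (edge (gph T)).

Section Generators.
Variables (A : star_alg R) (P : E0 -> G -> A) (S : E1 -> G -> A).
Hypothesis F : GE_family P S.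

Lemma triple_elt_vtriple v f : triple_elt P S (tval (vtriple v f)) = P v f.
Proof.
rewrite /= /path_elt /= (GEfam_star F) (GEfam_PP F) invg1 actv1.
by rewrite avVK eqxx mulg1.
Qed.

Lemma triple_elt_etriple e g : triple_elt P S (tval (etriple e g)) = S e g.
Proof.
rewrite /= /path_elt /= (edge_eltP F) (GEfam_star F) (GEfam_SP F) invg1 actv1.
by rewrite avVK eqxx mulg1.
Qed.

(** The vertex projection at the source of [c], inserted in the middle, is expanded by the sum
    relation. *)
Lemma triple_elt_idem_sum (c : prepath T) : is_path c ->
  triple_elt P S (c, 1%g, c) = \sum_(e \in [set e | rng e = psrc c])
    triple_elt P S (pcat c (epath e), 1%g, pcat c (epath e)).
Proof.
move=> pc; rewrite /= -{1}(path_elt_src F c 1%g) (Efam_sum (GEfam_E F)).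
rewrite !fsbig_finite; try exact: gph_row_finite.
rewrite amul_sumr amul_suml; apply: eq_big_seq => e.
rewrite in_fset_set ?inE /=; last exact: gph_row_finite.
move=> er; rewrite path_elt_cat //; last exact: is_path_pcat_epath.
by rewrite /path_elt /= (edge_eltP F) astarM !amulA.
Qed.

Lemma Leval_triple_elt r : Leval P S (triple_elt (@Lp R T) (@Ls R T) r) =
  triple_elt P S r.
Proof.
have H v p g : Leval P S (seq_elt (@Lp R T) (@Ls R T) v p g) = seq_elt P S v p g.
  elim: p v => [|e p IH] v /=; first exact: Leval_p.
  by rewrite LevalMr // IH Leval_s.
case: r => -[[v p] g] [w q].
by rewrite /= /path_elt LevalMr // LevalJr // !H.
Qed.

End Generators.

(** By induction on [a], the path element of [a] and [g] is the indicator for [(a, g, g^-1 . s(a))];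
    two such triples, one of them starred, multiply to [s]. *)
Lemma triple_elt_ind (s : triple T) :
  triple_elt (@indP R T) (@indS R T) (tval s) = @theta_ind R T (Some s).
Proof.
have pP (a : prepath T) g : is_path a ->
  is_triple (a, g, vpath (av g^-1%g (psrc a))).
  by move=> pa; rewrite /is_triple pa /= /psrc /= avVK eqxx.
have pathE (a : prepath T) g (pa : is_path a) :
    path_elt (@indP R T) (@indS R T) a g = theta_ind R (Some (Triple (pP a g
      pa))).
  case: a pa => v p; rewrite /path_elt /is_path /=.
  elim: p v => [|e p IH] v pa.
    by congr (theta_ind R (Some _)); apply: val_inj.
  have /andP[/eqP ev pp] : (rng e == v) && composable (src e) p by [].
  rewrite -[LHS]/(theta_ind R (Some (etriple e 1%g)) ** seq_elt _ _ (src e) p g).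
  rewrite (IH _ pp) ind_mulE /= /pprefix /= invg1 actv1.
  rewrite eqxx prefix0s /=.
  rewrite (insub_triple (t := Triple (pP (v, e :: p) g pa))) //=.
  by rewrite /pcat /pact /pphi act_seq1 phis1 mul1g /= drop0 ev.
rewrite (triple_eta s) /triple_elt !pathE ?tleftP ?trightP // => pa pb.
rewrite ind_starE ind_mulE /= /pprefix /= invg1 actv1.
rewrite psrc_tleft avK eqxx /= (insub_triple (t := s)) //.
rewrite (triple_eta s) /pcat /pact /pphi /= cats0 mulg1.
by case: (tleft s).
Qed.

Definition Lelt (s : SGE T) : LGE R T :=
  if s is Some t then triple_elt (@Lp R T) (@Ls R T) (tval t) else 0.

Lemma LeltM s t : Lelt s ** Lelt t = Lelt (smul s t).
Proof.
case: s t => [s|] [t|]; rewrite ?amul0r ?amulr0 //.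
rewrite /Lelt (triple_elt_mul (LGE_family R T)) /= /triple_mul.
case E : (pre_mul _ _) => [r|] //=.
have [u <- _] := pre_mul_Some E.
by rewrite (insub_triple (t := u)).
Qed.

Lemma LeltJ s : (Lelt s)^# = Lelt (sstar s).
Proof.
by case: s => [s|]; [exact: (triple_elt_star (LGE_family R T)) | exact: astar0].
Qed.

Lemma Leval_Lelt s :
  Leval (@indP R T) (@indS R T) (Lelt s) = @theta_ind R T s.
Proof.
case: s => [s|] /=.
  by rewrite Leval_triple_elt ?triple_elt_ind //; exact: ind_family.
by rewrite ind0; exact: (Leval0 (ind_family R T)).
Qed.

Definition Llin (m : seq (R * SGE T)) : LGE R T := \sum_(p <- m) p.1 *: Lelt p.2.

Lemma Leval_Llin m :
  val (Leval (@indP R T) (@indS R T) (Llin m)) = lincomb m.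
Proof.
have F := ind_family R T.
elim: m => [|p m IH]; rewrite /Llin.
  by rewrite big_nil (Leval0 F); apply: funext => z; rewrite /lincomb big_nil.
rewrite big_cons LevalDr // LevalZr // Leval_Lelt.
rewrite -[LHS]/(p.1 *: val (theta_ind R p.2) + val (Leval (@indP R T) (@indS R
  T) (Llin m))).
rewrite IH val_ind; apply: funext => z.
by rewrite /lincomb big_cons.
Qed.

(** The generators come from triples, and combinations of triple elements are closed under all
    operations by [LeltM] and [LeltJ]. *)
Lemma Llin_ex (a : LGE R T) : exists m, a = Llin m.
Proof.
move: a; apply: LGE_ind => [v f|e g|r a b [m ->] [n ->]|a b [m ->] [n ->]|a [m
  ->]|].
- exists [:: (1, Some (vtriple v f))]; rewrite /Llin big_seq1 scale1r.
  exact/esym/(triple_elt_vtriple (LGE_family R T)).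
- exists [:: (1, Some (etriple e g))]; rewrite /Llin big_seq1 scale1r.
  exact/esym/(triple_elt_etriple (LGE_family R T)).
- exists ([seq (r * p.1, p.2) | p <- m] ++ n); rewrite /Llin big_cat big_map.
  by rewrite scaler_sumr; congr (_ + _); apply: eq_bigr => p _; rewrite scalerA.
- exists [seq (p.1 * q.1, smul p.2 q.2) | p <- m, q <- n].
  rewrite /Llin big_allpairs_dep amul_suml; apply: eq_bigr => p _.
  rewrite amul_sumr; apply: eq_bigr => q _.
  by rewrite -scale_amull -scale_amulr LeltM scalerA.
- exists [seq (conjr R p.1, sstar p.2) | p <- m]; rewrite /Llin big_map.
  elim: m => [|p m IH]; first by rewrite !big_nil astar0.
  by rewrite !big_cons astarZD IH LeltJ.
- by exists [::]; rewrite /Llin big_nil.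
Qed.

End UniversalElements.

(** * Uniqueness, injectivity and surjectivity of pi *)

Section PiIsomorphism.
Local Open Scope ring_scope.
Variables (R : star_ring) (T : self_similar).
Local Notation G := (grp T).
Local Notation E0 := (vert (gph T)).
Local Notation E1 := (edge (gph T)).
Implicit Types (x : ipath T) (b c : prepath T) (z : Gtight T) (m :
  seq (R * SGE T)).
Implicit Types (s t u : SGE T).

Definition piGE (a : LGE R T) : Gtight T -> R :=
  val (Leval (@indP R T) (@indS R T) a).

Lemma is_piGE_piGE : is_piGE piGE.
Proof.
have F := ind_family R T; have [sP sZD sM sJ] := steinberg_val_hom R T.
have [hZD hM hJ] := Leval_hom F.
split.
- split=> [a|r a b z|a b|a]; rewrite /piGE.
  + exact: sP.
  + by rewrite hZD sZD.
  + by rewrite hM sM.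
  + by rewrite hJ sJ.
- by move=> v f; rewrite /piGE Leval_p // val_ind.
- by move=> e g; rewrite /piGE Leval_s // val_ind.
Qed.

Lemma steinberg_hom0 (A : star_alg R) (h : A -> Gtight T -> R) :
  steinberg_hom h -> h 0 = (fun=> 0).
Proof.
move=> H; apply: funext => z; have := steinberg_homZD H 1 0 0 z.
by rewrite scale1r addr0 mul1r => E; apply: (addrI (h 0 z)); rewrite -E addr0.
Qed.

Lemma is_piGE_unique (h k : LGE R T -> Gtight T -> R) :
  is_piGE h -> is_piGE k -> h = k.
Proof.
move=> [hh hp hs] [kh kp ks]; apply: funext.
apply: LGE_ind => [v f|e g|r a b Ea Eb|a b Ea Eb|a Ea|].
- by rewrite hp kp.
- by rewrite hs ks.
- apply: funext => z.
  by rewrite (steinberg_homZD hh) (steinberg_homZD kh) Ea Eb.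
- by rewrite (steinberg_homM hh) (steinberg_homM kh) Ea Eb.
- by rewrite (steinberg_homJ hh) (steinberg_homJ kh) Ea.
- by rewrite (steinberg_hom0 hh) (steinberg_hom0 kh).
Qed.

Lemma big_partition_key (V : nmodType) (I K : eqType) (l : seq I)
    (k : I -> K) (f : I -> V) :
  \sum_(i <- l) f i = \sum_(j <- undup (map k l)) \sum_(i <- l | k i == j) f i.
Proof.
under [RHS]eq_bigr do rewrite big_mkcond.
rewrite exchange_big; apply: eq_big_seq => i il.
rewrite (bigD1_seq (k i)) ?undup_uniq ?mem_undup ?map_f //= eqxx.
by rewrite big1 ?addr0 // => j; rewrite eq_sym => /negPf ->.
Qed.

Lemma piGE_Llin m : piGE (Llin m) = lincomb m.
Proof. exact: Leval_Llin. Qed.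

(** The choice is canonical, since [Theta0 s] has at most one germ over [x]; [None] covers the paths
    outside the domain of [s]. *)
Definition germ_at x s : option (Gtight T) :=
  if pselect (exists z, Theta0 s z /\ gsrc z = x) is left H then Some (projT1
    (cid H)) else None.

Lemma germ_atP x s z : germ_at x s = Some z <-> Theta0 s z /\ gsrc z = x.
Proof.
rewrite /germ_at; case: pselect => [H|nH]; last first.
  by split=> // H; case: nH; exists z.
case: (cid H) => w /= [sw wx]; split=> [[<-] //|[sz zx]]; congr Some.
case: s sw sz {H} => [s|] //= sw sz.
by apply: (Theta_src_inj (mem_set sw) (mem_set sz)); rewrite wx.
Qed.

(** If [x] is in the domain of [s], the product is a restriction of [s], which for large [n] is
    fixed by the germ. Otherwise a prefix of [x] at least as long as [tright s] is incomparable with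
    it, and the product is zero. *)
Lemma smul_iprefix x s : exists N, forall n, (N <= n)%N ->
  smul s (Some (tidem (is_path_iprefix x n))) =
  if germ_at x s is Some z then obind insub (gdata z n) else None.
Proof.
case: s => [s|]; last first.
  by exists 0%N => n _; case E : (germ_at _ _) => [z|] //; have /germ_atP[] := E.
have [sx|nsx] := pselect (cyl (tright s) x).
  have -> : germ_at x (Some s) = Some (germ sx).
    by apply/germ_atP; split; [exact: Theta_germ | exact: gsrc_germ].
  by have [N H] := gdata_germ sx; exists N => n /H ->.
exists (size (tright s).2) => n sn.
have -> : germ_at x (Some s) = None.
  case E : (germ_at _ _) => [z|] //; have /germ_atP[[y [sy ->]]] := E.
  by rewrite gsrc_germ => xy; case: nsx; rewrite -xy.
have nst : ~~ pprefix (tright s) (iprefix x n).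
  apply/negP => /pprefixP [d dE]; apply: nsx.
  have pd := is_path_iprefix x n; have := cyl_iprefix x n; rewrite dE in pd *.
  by case/(cyl_pcat _ pd).
apply: smul_None.
have [[e [te _]]|[[e [se _]]|[_ _ ->]]] :=
  smul_cases s (tidem (is_path_iprefix x n)) => //.
  by case/negP: nst; apply/pprefixP; exists e.
(* As [n] is at least the length of [tright s], the remainder is empty and the two paths
   coincide. *)
case/negP: nst; have e0 : e.2 = [::].
  have := congr1 (fun a : prepath T => size a.2) se;
    rewrite /= size_cat size_mkseq => E.
  by apply: size0nil; lia.
apply/pprefixP; exists e; rewrite se /pcat /= e0 !cats0.
by [].
Qed.

Lemma eventually_all (I : eqType) (l : seq I) (Q : I -> nat -> Prop) :
  (forall i, i \in l -> exists N, forall n, (N <= n)%N -> Q i n) ->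
  exists n, forall i, i \in l -> Q i n.
Proof.
move=> H; suff [N NP] : exists N, forall n, (N <= n)%N -> forall i, i \in l ->
  Q i n.
  by exists N; exact: NP.
elim: l H => [|j l IH] H; first by exists 0%N.
have [N1 H1] := H j (mem_head _ _).
have [|N2 H2] := IH; first by move=> i il; apply: H; rewrite inE il orbT.
exists (maxn N1 N2) => n; rewrite geq_max => /andP[n1 n2] i.
by rewrite inE => /orP[/eqP->|il]; [exact: H1 | exact: H2].
Qed.

(* At a long prefix of [x] the terms of [m] with the same germ at [x] become
   equal, and the coefficients of each germ at [x] sum to its value, zero. *)
Lemma Llin_vanish m x : lincomb m = 0 ->
  exists n, Llin m ** Lelt R (Some (tidem (is_path_iprefix x n))) = 0.
Proof.
move=> m0; have [n nP] := @eventually_all _ m (fun p n =>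
  smul p.2 (Some (tidem (is_path_iprefix x n))) =
  if germ_at x p.2 is Some z then obind insub (gdata z n) else None)
  (fun p _ => smul_iprefix x p.2).
exists n; pose u (k : option (Gtight T)) : LGE R T :=
  Lelt R (if k is Some z then obind insub (gdata z n) else None).
have -> : Llin m ** Lelt R (Some (tidem (is_path_iprefix x n))) =
    \sum_(p <- m) p.1 *: u (germ_at x p.2).
  rewrite /Llin amul_suml; apply: eq_big_seq => p pm.
  by rewrite -scale_amull LeltM nP.
rewrite (big_partition_key _ (fun p => germ_at x p.2)) big1_seq // => k _.
under eq_bigr => p /eqP -> do [].
case: k => [z|]; last by rewrite big1 // => p _; exact: scaler0.
rewrite -scaler_suml.
suff -> : \sum_(p <- m | germ_at x p.2 == Some z) p.1 = 0 by rewrite scale0r.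
(* Over another source than [x] no term has germ [z]; over [x] the terms with germ [z] are those
   whose set contains [z]. *)
have [zx|nzx] := eqVneq (gsrc z) x; last first.
  by rewrite big1 // => p /eqP/germ_atP[_ /eqP]; rewrite (negbTE nzx).
have mz : lincomb m z = 0 by rewrite m0.
rewrite -[RHS]mz /lincomb big_mkcond.
apply: eq_bigr => p _; rewrite indicE.
have -> : (z \in Theta0 p.2) = (germ_at x p.2 == Some z).
  apply/idP/eqP; first by rewrite inE => pz; apply/germ_atP.
  by move=> /germ_atP[pz _]; rewrite inE.
by case: eqP; rewrite ?mulr1 ?mulr0.
Qed.

Lemma Lelt_vpath s v : Lelt R s ** Lelt R (Some (tidem (is_path_vpath v))) =
  if s is Some t then (if (tright t).1 == v then Lelt R s else 0) else 0.
Proof.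
case: s => [s|]; last exact: amul0r.
rewrite LeltM; have [vs|nvs] := eqVneq (tright s).1 v; last first.
  suff -> : smul (Some s) (Some (tidem (is_path_vpath v))) = None by [].
  apply: smul_None; rewrite (triple_eta s) /= /pprefix /= (eq_sym v).
  by rewrite (negbTE nvs).
congr (Lelt R _).
have [[e [te E]]|[[e [se E]]|[_ n2 _]]] :=
  smul_cases s (tidem (is_path_vpath v)); last first.
- by case/negP: n2; rewrite /pprefix /= vs eqxx prefix0s.
- rewrite /= /triple_mul E /= (insub_triple (t := s)) //.
  rewrite (triple_eta s) se /tgrp /tright /tleft /= /pphi !invg1 phis1 invg1
    mulg1.
  by rewrite /pcat /pact /= act_seq1.
(* Here [tright s] is a prefix of a path of length zero, so it is itself a vertex. *)
have /esym/nilP := congr1 snd te; rewrite /nilp size_cat addn_eq0.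
move=> /andP[/eqP/size0nil s0 /eqP/size0nil e0].
rewrite /= /triple_mul E /= (insub_triple (t := s)) //.
rewrite (triple_eta s) /pcat /pact /pphi /= e0 cats0 /= mulg1.
have -> : tright s = vpath v by rewrite -vs /vpath -s0; case: (tright s).
by case: (tleft s).
Qed.

Lemma Llin0 m : lincomb m = 0 -> Llin m = 0.
Proof.
move=> m0.
have vz v : Llin m ** Lelt R (Some (tidem (is_path_vpath v))) = 0.
  pose P c := Llin m ** triple_elt (@Lp R T) (@Ls R T) (c, 1%g, c) = 0.
  apply: (@iprefix_ext T P); last 2 first.
  - exact: is_path_vpath.
  - move=> x /(cylP _ (is_path_vpath v)) xv.
    have [n nE] := Llin_vanish x m0; exists n; exact: nE.
  - move=> c pc Pc; rewrite /P (triple_elt_idem_sum (LGE_family R T)) //.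
    rewrite fsbig_finite; last exact: gph_row_finite.
    rewrite amul_sumr big1_seq // => e /andP[_].
    rewrite in_fset_set ?inE; last exact: gph_row_finite.
    exact: Pc.
(* Terms are grouped by the range of their right path. The group of [v] is the product with [p_v],
   zero by [vz]; the group [None] consists of zero terms. *)
rewrite /Llin (big_partition_key _ (fun p => omap (fun t : triple T =>
  (tright t).1) p.2)).
rewrite big1_seq // => -[v|] _; last first.
  by rewrite big1 // => -[r [t|]] //= _; rewrite scaler0.
rewrite -[RHS](vz v) /Llin amul_suml big_mkcond; apply: eq_bigr => p _.
rewrite -scale_amull Lelt_vpath; case: p => r [t|]; last by rewrite scaler0.
by rewrite /= (inj_eq (@Some_inj _)); case: ifP => //; rewrite scaler0.
Qed.

Lemma piGE_inj : injective piGE.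
Proof.
move=> a b E; apply/eqP; rewrite -subr_eq0; apply/eqP.
have [hh _ _] := is_piGE_piGE.
have [m mE] := Llin_ex (a - b); rewrite mE; apply: Llin0.
rewrite -piGE_Llin -mE; apply: funext => z.
have -> : a - b = -1 *: b + a by rewrite scaleN1r addrC.
by rewrite (steinberg_homZD hh) E mulN1r addNr.
Qed.

Lemma lincomb_bisection (B : set (Gtight T)) : compact_open_bisection B ->
  exists m, lincomb m = \1_B.
Proof.
move=> [cB oB Binj _]; have [l lB ->] := compact_open_Theta cB oB.
suff [m [_ mE]] : exists m, (forall p, p \in m -> Theta0 p.2 `<=` B) /\
    lincomb m = \1_(\bigcup_(s in [set` l]) Theta s) by exists m.
elim: l lB => [|s l IH] lB.
  exists [::]; split=> //; apply: funext => z; rewrite /lincomb big_nil.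
  by rewrite indicE memNset // => -[].
have sB : Theta s `<=` B by apply: lB; rewrite mem_head.
have [|m [mB mE]] := IH; first by move=> t tl; apply: lB; rewrite inE tl orbT.
have /choice[r rP] : forall t, exists r, Theta0 t `<=` B ->
    Theta s `&` Theta0 t = Theta0 r.
  move=> [t|]; last by exists None; rewrite setI0.
  have [tB|nt] := pselect (Theta t `<=` B); last by exists None.
  by have [r rE] := Theta_nested Binj sB tB; exists r.
(* Inclusion-exclusion for the union with [Theta s]: the subtracted product of indicators is
   obtained by intersecting each set of [m] with [Theta s], which is what [r] does. *)
exists ((1, Some s) :: m ++ [seq (- p.1, r p.2) | p <- m]); split.
  move=> p; rewrite inE mem_cat => /orP[/eqP ->
    //|/orP[/mB //|/mapP[q qm ->]] /=].
  by rewrite -rP; [move=> z [/sB] | exact: mB].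
apply: funext => z; rewrite /lincomb big_cons big_cat big_map /= mul1r.
have -> : \sum_(p <- m) - p.1 * \1_(Theta0 (r p.2)) z =
    - (\1_(Theta s) z * lincomb m z) :> R.
  rewrite /lincomb big_distrr -sumrN; apply: eq_big_seq => p pm /=.
  by rewrite -rP ?indicI /= ?mulNr 1?mulrCA //; exact: mB.
rewrite -/(lincomb m z) mE !indicE.
have -> : (z \in \bigcup_(i in [set` s :: l]) Theta i) =
    (z \in Theta s) || (z \in \bigcup_(i in [set` l]) Theta i).
  apply/idP/orP; rewrite !inE.
    move=> [i /=]; rewrite inE => /orP[/eqP -> sz|il iz]; first by left.
    by right; exists i.
  move=> [sz|[i il iz]]; first by exists s; rewrite //= mem_head.
  by exists i => //=; rewrite inE orbC [i \in l]il.
case: (z \in Theta s); last by rewrite mul0r oppr0 addr0 add0r.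
by rewrite mul1r addrN addr0.
Qed.

Lemma piGE_surj (f : Gtight T -> R) : steinberg R T f -> exists a, piGE a = f.
Proof.
move=> [n [c [B [BP fE]]]].
have /choice[m mE] i := lincomb_bisection (BP i).
suff : (f : Gtight T -> R^o) \in @theta_span R T.
  by move=> /theta_spanP[k ->]; exists (Llin k); rewrite piGE_Llin.
have -> : f = \sum_(i < n) c i *: lincomb (m i).
  apply: funext => z; rewrite fE (big_morph (@^~ z) (id1 := 0) (op1 := +%R)) //.
  by apply: eq_bigr => i _; rewrite mE.
by apply: rpred_sum => i _; apply: rpredZ; exact: lincomb_span.
Qed.

End PiIsomorphism.

Theorem theoremB (R : star_ring) (T : self_similar)
    (hausdorffG : hausdorff_space (Gtight T)) :
  exists pi : LGE R T -> (Gtight T -> R),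
    unique (@is_piGE R T) pi /\
    set_bij [set: LGE R T] (steinberg R T) pi.
Proof.
have piP := is_piGE_piGE R T.
exists (@piGE R T); split; first by split=> // h hP; exact: is_piGE_unique.
split=> [a _|a b _ _|f /piGE_surj[a aE]].
- by have [hh _ _] := piP; exact: (steinberg_homP hh).
- exact: piGE_inj.
- by exists a.
Qed.
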